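(* Let $r\ge t\ge 2$ be integers, let $\mathscr{T}\in\{\mathscr{S},\mathscr{S}_<,\mathscr{S}^{\blacktriangleleft},\mathscr{S}^{\blacktriangleleft}_<\}$, and let $F\in\mathscr{T}(r,t)$. Consider the conditions: (i) if $\mathscr{T}(r,t)$ is unordered (i.e. $\mathscr{T}\in\{\mathscr{S},\mathscr{S}^{\blacktriangleleft}\}$), then $F$ is homogeneous; (ii) if $\mathscr{T}(r,t)$ is weak (i.e. $\mathscr{T}\in\{\mathscr{S},\mathscr{S}_<\}$) and $t<r$, then $F$ is a complete Steiner $(r,t)$-system. If both (i) and (ii) hold, then $\mathscr{T}(r,t)$ has the $F$-Ramsey property. If (i) or (ii) fails, then $\mathscr{T}(r,t)$ does not have the $F$-Ramsey property.
   Context: An $r$-graph is a pair $G=(V,E)$ with $E\subseteq\binom{V}{r}$; $G\le H$ (induced subhypergraph) means $V(G)\subseteq V(H)$ and $E(G)=E(H)\cap\binom{V(G)}{r}$. For $r\ge t\ge 2$, a Steiner $(r,t)$-system is an $r$-graph in which every $t$-subset of vertices lies in at most one edge. $G$ is a strongly induced subsystem of $H$ ($G\blacktriangleleft H$) if $G\le H$ and $|e\cap V(G)|<t$ for all $e\in E(H)\setminus E(G)$. An ordered Steiner system carries a fixed linear order on its vertices; subsystems inherit the order and isomorphisms must preserve order. The four classes: $\mathscr{S}(r,t)$: Steiner $(r,t)$-systems, usual isomorphisms, subobjects = induced subsystems; $\mathscr{S}_<(r,t)$: ordered Steiner $(r,t)$-systems, order-preserving isomorphisms, subobjects = induced subsystems;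 $\mathscr{S}^{\blacktriangleleft}(r,t)$: Steiner $(r,t)$-systems with subobjects = strongly induced subsystems; $\mathscr{S}^{\blacktriangleleft}_<(r,t)$: ordered ones with subobjects = strongly induced subsystems. $\mathscr{S},\mathscr{S}^{\blacktriangleleft}$ are called unordered, $\mathscr{S}_<,\mathscr{S}^{\blacktriangleleft}_<$ ordered; $\mathscr{S},\mathscr{S}_<$ are called weak, the others strong. For objects $F,G$ in a class, $\binom{G}{F}$ denotes the set of subobjects of $G$ isomorphic to $F$. $H\to(G)^F_c$ means: for every colouring of $\binom{H}{F}$ with $c$ colours there is $\widetilde G\in\binom{H}{G}$ with $\binom{\widetilde G}{F}$ monochromatic. The class has the $F$-Ramsey property if for every $G$ in the class and every positive integer $c$ there is $H$ in the class with $H\to(G)^F_c$. A Steiner $(r,t)$-system $F$ is homogeneous if every permutation of $V(F)$ is an automorphism of $F$; it is complete if every $t$-subset of $V(F)$ is contained in some edge of $F$. For ordered $F$, homogeneity and completeness refer to the underlying unordered system. *)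

(* Defs.v *)
From HB Require Import structures.
From mathcomp Require Import all_boot all_fingroup.

Set Implicit Arguments.
Unset Strict Implicit.
Unset Printing Implicit Defensive.

(** Vertices live in an ambient finite type [T], which may be strictly larger
    than the vertex set.  In this way a subsystem of a hypergraph on [T] is
    again a hypergraph on [T], with a smaller vertex set. *)
Record hypergraph (T : finType) := Hypergraph {
  vset : {set T};
  eset : {set {set T}}
}.

(** [(x, y) \in vord G] means that x <= y in the order of G. *)
Record ohypergraph (T : finType) := OHypergraph {
  unordered :> hypergraph T;
  vord : {set T * T}
}.

Definition rgraph (r : nat) (T : finType) (G : hypergraph T) : Prop :=
  forall e, e \in eset G -> e \subset vset G /\ #|e| = r.

Definition steiner (r t : nat) (T : finType) (G : hypergraph T) : Prop :=
  rgraph r G /\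
  forall S : {set T}, S \subset vset G -> #|S| = t ->
  forall e e', e \in eset G -> e' \in eset G ->
    S \subset e -> S \subset e' -> e = e'.

(** The first clause makes the order a relation on [V] only, so that an ordered
    system is determined by its vertices, its edges and its order on them. *)
Definition linear_order_on (T : finType) (V : {set T}) (R : {set T * T}) : Prop :=
  [/\ R \subset setX V V,
      forall x, x \in V -> (x, x) \in R,
      forall x y, (x, y) \in R -> (y, x) \in R -> x = y,
      forall x y z, (x, y) \in R -> (y, z) \in R -> (x, z) \in R
    & forall x y, x \in V -> y \in V -> (x, y) \in R \/ (y, x) \in R].

Definition induced (r : nat) (T : finType) (G H : hypergraph T) : Prop :=
  vset G \subset vset H /\
  eset G = eset H :&: [set e : {set T} | e \subset vset G & #|e| == r].

Definition strongly_induced (r t : nat) (T : finType) (G H : hypergraph T) : Prop :=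
  induced r G H /\
  forall e, e \in eset H :\: eset G -> #|e :&: vset G| < t.

Definition inherits_order (T : finType) (G H : ohypergraph T) : Prop :=
  vord G = vord H :&: setX (vset G) (vset G).

Definition vertex (T : finType) (G : hypergraph T) : finType :=
  {x : T | x \in vset G}.

Definition is_iso (T U : finType) (G : hypergraph T) (H : hypergraph U)
    (f : vertex G -> vertex H) : Prop :=
  bijective f /\
  forall e : {set vertex G},
    (val @: e \in eset G) = (val @: (f @: e) \in eset H).

Definition preserves_order (T U : finType) (G : ohypergraph T)
    (H : ohypergraph U) (f : vertex G -> vertex H) : Prop :=
  forall x y : vertex G,
    ((val x, val y) \in vord G) = ((val (f x), val (f y)) \in vord H).

Definition homogeneous (T : finType) (F : hypergraph T) : Prop :=
  forall s : {perm vertex F}, is_iso s.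

Definition complete (t : nat) (T : finType) (F : hypergraph T) : Prop :=
  forall S : {set T}, S \subset vset F -> #|S| = t ->
  exists2 e, e \in eset F & S \subset e.

Inductive steiner_class := Weak | WeakOrd | Strong | StrongOrd.

Definition is_ordered (C : steiner_class) : bool :=
  match C with Weak | Strong => false | WeakOrd | StrongOrd => true end.

Definition is_weak (C : steiner_class) : bool :=
  match C with Weak | WeakOrd => true | Strong | StrongOrd => false end.

Definition object (C : steiner_class) (T : finType) : Type :=
  if is_ordered C then ohypergraph T else hypergraph T.

Definition underlying (C : steiner_class) (T : finType) :
    object C T -> hypergraph T :=
  match C with
  | Weak | Strong => fun G => G
  | WeakOrd | StrongOrd => fun G => unordered G
  end.

Definition in_class (C : steiner_class) (r t : nat) (T : finType) :
    object C T -> Prop :=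
  match C with
  | Weak | Strong => fun G : hypergraph T => steiner r t G
  | WeakOrd | StrongOrd => fun G : ohypergraph T =>
      steiner r t G /\ linear_order_on (vset G) (vord G)
  end.

Definition subobject (C : steiner_class) (r t : nat) (T : finType) :
    object C T -> object C T -> Prop :=
  match C with
  | Weak => fun G H : hypergraph T => induced r G H
  | WeakOrd => fun G H : ohypergraph T => induced r G H /\ inherits_order G H
  | Strong => fun G H : hypergraph T => strongly_induced r t G H
  | StrongOrd => fun G H : ohypergraph T =>
      strongly_induced r t G H /\ inherits_order G H
  end.

Definition isomorphic (C : steiner_class) (T U : finType) :
    object C T -> object C U -> Prop :=
  match C with
  | Weak | Strong => fun (G : hypergraph T) (H : hypergraph U) =>
      exists f : vertex G -> vertex H, is_iso f
  | WeakOrd | StrongOrd => fun (G : ohypergraph T) (H : ohypergraph U) =>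
      exists f : vertex G -> vertex H, is_iso f /\ preserves_order f
  end.

(** [copy r t G F X] : X is an element of \binom{G}{F}. *)
Definition copy (C : steiner_class) (r t : nat) (T U : finType)
    (G : object C T) (F : object C U) (X : object C T) : Prop :=
  subobject r t X G /\ isomorphic X F.

(** A colouring is given as a total function; only its values on \binom{H}{F}
    are ever used, since copies of F in a copy of G are copies of F in H. *)
Definition arrow (C : steiner_class) (r t : nat) (TH TG TF : finType)
    (H : object C TH) (G : object C TG) (F : object C TF) (c : nat) : Prop :=
  forall chi : object C TH -> 'I_c,
  exists2 G' : object C TH, copy r t H G G' &
  exists i : 'I_c, forall X, copy r t G' F X -> chi X = i.

Definition ramsey_property (C : steiner_class) (r t : nat) (TF : finType)
    (F : object C TF) : Prop :=
  forall (TG : finType) (G : object C TG) (c : nat),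
    in_class r t G -> 0 < c ->
  exists (TH : finType) (H : object C TH),
    in_class r t H /\ arrow r t H G F c.

(* Main.v *)
Require Import Defs.
From HB Require Import structures.
From mathcomp Require Import all_boot all_fingroup.
From mathcomp Require Import zify.

Set Implicit Arguments.
Unset Strict Implicit.
Unset Printing Implicit Defensive.

(** Everything reduces to strong copies in ordered systems. A weak embedding of a
    complete system is strong, and a homogeneous system has the same copies with or
    without an order, so the positive half follows from the ordered strong class.

    There we run the partite construction over the ground set 'I_n given by Ramsey's
    theorem. It glues copies of the current system P over a set of |F| parts, and the
    result is a Steiner system with strong copies provided that two glued copies of P
    meet in a subset I of a strong copy of F such that every edge of F with t points
    in I lies in I. A Hales-Jewett cube almost has this property: it fails only for
    two lines with the same moving coordinates. But a line meets every point of the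
    cube inside one of its own tuples, so a second partite construction, over the
    cube as ground set and gluing by Hales-Jewett again, repairs it.

    For the negative half, colour a copy of F by its order type relative to an order
    of H if F is not homogeneous. If the class is weak and F not complete, fix a t-set S of F in
    no edge, and colour a copy of F red if the edge of H through its copy of S has a
    vertex above all of that copy of F. The ordering property yields G forcing both
    colours. *)

(** * Hales-Jewett and Ramsey theorems *)

Definition line_point (X A : finType) (l : {ffun X -> option A}) (a : A) :
  {ffun X -> A} := [ffun x => odflt a (l x)].

Definition moving (X A : finType) (l : {ffun X -> option A}) :=
  [exists x, l x == None].

(** Colour focusing. The induction removes letters from [S] while the alphabet type stays fixed; [c]
    varies because the induction hypothesis is applied to colours that are themselves colourings. *)
Lemma hales_jewett_set (A : finType) (S : {set A}) (c : finType) :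
  S != set0 ->
  exists X : finType, forall chi : {ffun X -> A} -> c,
  exists2 l : {ffun X -> option A}, moving l &
    {in S &, forall a b, chi (line_point l a) = chi (line_point l b)}.
Proof.
move: {2}#|S| (leqnn #|S|) => n; elim: n S c => [|n IHn] S c.
  by rewrite leqn0 cards_eq0 => /eqP ->; rewrite eqxx.
move=> leSn /set0Pn[a0 a0S].
pose S0 := S :\ a0.
have [S00|S0n0] := eqVneq S0 set0.
  exists unit => chi; exists [ffun _ => None].
    by apply/existsP; exists tt; rewrite ffunE.
  have aE a : a \in S -> a = a0.
    move=> aS; apply/eqP/negP => /negP na; have : a \in S0 by rewrite !inE na.
    by rewrite S00 inE.
  by move=> a b /aE -> /aE ->.
have leS0 : #|S0| <= n by move: leSn; rewrite (cardsD1 a0) a0S.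
have [b0 b0S] := set0Pn _ S0n0.
have SE a : a \in S -> a = a0 \/ a \in S0.
  by move=> aS; have [->|na] := eqVneq a a0; [left|right; rewrite !inE na].
(* Either some line is already monochromatic on [S], or [r] lines share the point [f] at [a0] and
   have distinct colours on [S0]. The second case is impossible once [r] exceeds the number of
   colours. *)
suff focus r : exists X : finType, forall chi : {ffun X -> A} -> c,
    (exists2 l : {ffun X -> option A}, moving l &
      {in S &, forall a b, chi (line_point l a) = chi (line_point l b)}) \/
    exists (f : {ffun X -> A}) (ls : seq {ffun X -> option A}),
    [/\ size ls = r, uniq [seq chi (line_point l b0) | l <- ls]
      & forall l, l \in ls -> [/\ moving l, line_point l a0 = f &
          {in S0 &, forall a b, chi (line_point l a) = chi (line_point l b)}]].
  have [X HX] := focus #|c|.+1; exists X => chi.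
  have [//|[f [ls [sz un _]]]] := HX chi.
  by have := max_card (mem [seq chi (line_point l b0) | l <- ls]);
     rewrite (card_uniqP un) size_map sz ltnn.
elim: r => [|r [X HX]].
  by exists unit => chi; right; exists [ffun _ => a0], [::].
(* A point of the [Y]-cube is coloured by the whole colouring that it induces on the [X]-cube. *)
have [Y HY] := IHn S0 {ffun {ffun X -> A} -> c} leS0 S0n0.
exists (X + Y)%type => chi.
pose pr (u : {ffun X -> A}) (v : {ffun Y -> A}) : {ffun X + Y -> A} :=
  [ffun z => match z with inl x => u x | inr y => v y end].
pose prl (u : {ffun X -> option A}) (v : {ffun Y -> option A}) :
    {ffun X + Y -> option A} :=
  [ffun z => match z with inl x => u x | inr y => v y end].
pose cst (Z : finType) (u : {ffun Z -> A}) : {ffun Z -> option A} :=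
  [ffun z => Some (u z)].
have prE u v a : line_point (prl u v) a = pr (line_point u a) (line_point v a).
  by apply/ffunP=> -[x|y]; rewrite !ffunE.
have cstE Z u a : line_point (@cst Z u) a = u.
  by apply/ffunP=> z; rewrite !ffunE.
have [l' mv' mono'] := HY (fun v => [ffun u => chi (pr u v)]).
have {}mono' u : {in S0 &, forall a b,
    chi (pr u (line_point l' a)) = chi (pr u (line_point l' b))}.
  by move=> a b aS bS; have /ffunP/(_ u) := mono' _ _ aS bS; rewrite !ffunE.
have mvl u v : moving u -> moving (prl u v).
  by case/existsP=> x ux; apply/existsP; exists (inl x); rewrite ffunE.
have mvr u v : moving v -> moving (prl u v).
  by case/existsP=> x ux; apply/existsP; exists (inr x); rewrite ffunE.
have [[l mv mono]|[f [ls [sz un Hls]]]] :=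
    HX (fun u => chi (pr u (line_point l' b0))).
  left; exists (prl l (cst Y (line_point l' b0))); first exact: mvl.
  by move=> a b aS bS; rewrite !prE !cstE; apply: mono.
(* If the focus has the colour of one of the lines, that line is monochromatic on all of [S].
   Otherwise the line through [f] that moves only along [l'] brings a new colour, and the other
   lines are prolonged by [l']. *)
have [fin|fnin] := boolP (chi (pr f (line_point l' b0)) \in
    [seq chi (pr (line_point l b0) (line_point l' b0)) | l <- ls]).
  left; case/mapP: fin => l /Hls[mv foc mono] E.
  exists (prl l (cst Y (line_point l' b0))); first exact: mvl.
  suff H a : a \in S -> chi (pr (line_point l a) (line_point l' b0)) =
      chi (pr (line_point l b0) (line_point l' b0)).
    by move=> a b aS bS; rewrite !prE !cstE !H.
  by case/SE=> [->|aS]; [rewrite foc|apply: mono].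
right; exists (pr f (line_point l' a0)).
exists (prl (cst X f) l' :: [seq prl l l' | l <- ls]); split.
- by rewrite /= size_map sz.
- rewrite /= -map_comp prE cstE; apply/andP; split.
    apply: contra fnin => /mapP[l lin /= E]; apply/mapP; exists l => //.
    by rewrite E prE.
  by rewrite (eq_map (g := fun l =>
    chi (pr (line_point l b0) (line_point l' b0)))) // => l /=; rewrite prE.
move=> l; rewrite inE => /orP[/eqP->|/mapP[l0 /Hls[mv foc mono] ->]].
  split; [exact: mvr|by rewrite prE cstE|].
  by move=> a b aS bS; rewrite !prE !cstE; apply: mono'.
split; [exact: mvr|by rewrite prE foc|].
move=> a b aS bS; rewrite !prE.
by rewrite (mono' _ a b0) // (mono' _ b b0) //; apply: mono.
Qed.

Lemma hales_jewett (A c : finType) : 0 < #|A| ->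
  exists X : finType, forall chi : {ffun X -> A} -> c,
  exists2 l : {ffun X -> option A}, moving l &
    forall a b, chi (line_point l a) = chi (line_point l b).
Proof.
move=> A0; have [|X HX] := @hales_jewett_set A setT c.
  by rewrite -card_gt0 cardsT.
by exists X => chi; have [l mv H] := HX chi; exists l => // a b; apply: H.
Qed.

Lemma exists_subset_card (T : finType) (X : {set T}) (m : nat) :
  m <= #|X| -> exists2 M : {set T}, M \subset X & #|M| = m.
Proof.
move=> le_m; exists [set x in take m (enum X)].
  by apply/subsetP=> x; rewrite inE => /mem_take; rewrite mem_enum.
rewrite cardsE; have /card_uniqP -> : uniq (take m (enum X)).
  exact: take_uniq (enum_uniq _).
by rewrite size_take -cardE; case: ltngtP le_m.
Qed.

(** Each colour has its own target, so that an inner induction on the sum of the targets can lower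
    one of them at a time. *)
Lemma ramsey_offdiagonal (k c : nat) (m : 'I_c -> nat) :
  exists n, forall (T : finType) (X : {set T}) (chi : {set T} -> 'I_c),
  n <= #|X| -> exists (i : 'I_c) (M : {set T}),
  [/\ M \subset X, #|M| = m i &
      forall S : {set T}, S \subset M -> #|S| = k -> chi S = i].
Proof.
elim: k m => [|k IHk] m.
  exists (\sum_i m i) => T X chi leX; exists (chi set0).
  have /exists_subset_card[M MX cM] : m (chi set0) <= #|X|.
    by apply: leq_trans leX; rewrite (bigD1 (chi set0)) //= leq_addr.
  by exists M; split=> // S _ /eqP; rewrite cards_eq0 => /eqP->.
move: {2}(\sum_i m i) (leqnn (\sum_i m i)) => w; elim: w m => [|w IHw] m lew.
  exists 0 => T X chi _; exists (chi set0), set0; split; first exact: sub0set.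
    by move: lew; rewrite leqn0 sum_nat_eq0 cards0 => /forallP/(_ (chi set0))/eqP->.
  by move=> S; rewrite subset0 => /eqP->; rewrite cards0.
have [/existsP[i /eqP mi0]|/existsPn mn0] := boolP [exists i, m i == 0].
  exists 0 => T X chi _; exists i, set0; split; first exact: sub0set.
    by rewrite cards0.
  by move=> S; rewrite subset0 => /eqP->; rewrite cards0.
pose md (i j : 'I_c) := if j == i then (m j).-1 else m j.
have /fin_all_exists[N HN] i : exists n, forall (T : finType) (X : {set T})
    (chi : {set T} -> 'I_c), n <= #|X| -> exists (j : 'I_c) (M : {set T}),
    [/\ M \subset X, #|M| = md i j &
      forall S : {set T}, S \subset M -> #|S| = k.+1 -> chi S = j].
  apply: IHw; move: lew; rewrite (bigD1 i) //= => lew.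
  rewrite (bigD1 i) //= {1}/md eqxx (eq_bigr m) => [|j].
    by move: (mn0 i) lew; case: (m i).
  by rewrite /md => /negPf->.
have [n Hn] := IHk N; exists n.+1 => T X chi ltX.
have /card_gt0P[x xX] : 0 < #|X| by apply: leq_trans ltX.
have leX : n <= #|X :\ x| by move: ltX; rewrite (cardsD1 x) xX.
(* In [Y] all [k]-sets extend by [x] to sets of colour [i]. Its size [N i] suffices for the targets
   with the [i]-th lowered by one; if that colour comes up, adding [x] makes up for the loss. *)
have [i [Y [YX cY HY]]] := Hn T (X :\ x) (fun S => chi (x |: S)) leX.
have [|j [M [MY cM HM]]] := HN i T Y chi; first by rewrite cY.
have xM : x \notin M.
  by apply/negP=> /(subsetP MY) /(subsetP YX); rewrite !inE eqxx.
have MX : M \subset X.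
  by apply: subset_trans (subset_trans MY YX) _; apply: subsetDl.
move: cM; rewrite /md; case: eqP => [ji|_] cM; last by exists j, M.
exists i, (x |: M); split.
- by rewrite subUset sub1set xX.
- by rewrite cardsU1 xM cM ji; have := mn0 i; case: (m i).
move=> S SM cS; have [xS|xS] := boolP (x \in S); last first.
  rewrite -ji; apply: HM => //; apply/subsetP=> y yS.
  by have := subsetP SM y yS; rewrite !inE => /orP[/eqP yx|//]; rewrite -yx yS in xS.
rewrite -(setD1K xS); apply: HY; last by move: cS; rewrite (cardsD1 x) xS => -[].
apply: subset_trans MY; apply/subsetP=> y; rewrite !inE => /andP[nyx yS].
by have := subsetP SM y yS; rewrite !inE (negPf nyx).
Qed.

Lemma ramsey (k c m : nat) :
  exists n, forall chi : {set 'I_n} -> 'I_c, exists (M : {set 'I_n}) (i : 'I_c),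
  #|M| = m /\ forall S : {set 'I_n}, S \subset M -> #|S| = k -> chi S = i.
Proof.
have [n Hn] := @ramsey_offdiagonal k c (fun=> m); exists n => chi.
have [|i [M [_ cM HM]]] := Hn _ setT chi; first by rewrite cardsT card_ord.
by exists M, i.
Qed.

(** * Order-preserving maps, with linear orders given by injective keys in [nat] *)

Definition monotone (B U : finType) (k : B -> nat) (k' : U -> nat) (f : B -> U) :=
  forall x y, k x < k y -> k' (f x) < k' (f y).

Definition position (B : finType) (k : B -> nat) (x : B) := #|[set y | k y < k x]|.

Section Monotone.
Variables (B : finType) (k : B -> nat).
Hypothesis k_inj : injective k.

Lemma key_neq x y : x != y -> k x < k y \/ k y < k x.
Proof.
move=> nxy; case: (ltngtP (k x) (k y)) => [| |/k_inj xy]; [by left|by right|].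
by rewrite xy eqxx in nxy.
Qed.

Lemma monotone_lt (U : finType) (k' : U -> nat) f : monotone k k' f ->
  forall x y, (k' (f x) < k' (f y)) = (k x < k y).
Proof.
move=> mf x y; apply/idP/idP => [lt|]; last exact: mf.
rewrite ltnNge leq_eqVlt; apply/norP; split.
  by apply/eqP=> /k_inj yx; rewrite yx ltnn in lt.
by apply/negP=> /mf; rewrite ltnNge (ltnW lt).
Qed.

Lemma monotone_inj (U : finType) (k' : U -> nat) f : monotone k k' f -> injective f.
Proof.
move=> mf x y fxy; apply/eqP/negP => /negP /key_neq[] /mf; by rewrite fxy ltnn.
Qed.

(** Strong induction on the key. If [f x = g y] and [g x = f z] with [y] and [z] both above [x],
    then [f x] and [g x] each lie above the other; if one of them is below [x], the induction
    hypothesis contradicts injectivity. *)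
Lemma monotone_imset_inj (U : finType) (k' : U -> nat) f g :
  monotone k k' f -> monotone k k' g -> f @: setT = g @: setT -> f =1 g.
Proof.
move=> mf mg fg x; move: {2}(k x) (leqnn (k x)) => n.
elim/ltn_ind: n x => n IHn x xn.
have lt_eq y : k y < k x -> f y = g y.
  by move=> yx; apply: (IHn (k y)) => //; apply: leq_trans yx xn.
have [y fxy] : exists y, f x = g y.
  have : f x \in g @: setT by rewrite -fg imset_f.
  by case/imsetP=> y _ ->; exists y.
have [z gxz] : exists z, g x = f z.
  have : g x \in f @: setT by rewrite fg imset_f.
  by case/imsetP=> z _ ->; exists z.
case: (ltngtP (k x) (k y)) => [lt_xy|lt_yx|/k_inj xy]; last by rewrite fxy xy.
- case: (ltngtP (k x) (k z)) => [lt_xz|lt_zx|/k_inj xz]; last by rewrite gxz xz.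
  + have := mf _ _ lt_xz; have := mg _ _ lt_xy; rewrite -fxy gxz; lia.
  + by have := lt_zx; rewrite -(monotone_lt mg) gxz -lt_eq // ltnn.
- by have := lt_yx; rewrite -(monotone_lt mf) fxy lt_eq // ltnn.
Qed.

Lemma position_lt x y : (position k x < position k y) = (k x < k y).
Proof.
have le a b : k a <= k b -> position k a <= position k b.
  move=> ab; apply: subset_leq_card; apply/subsetP=> z; rewrite !inE => za.
  exact: leq_trans za ab.
apply/idP/idP => [|lt]; first by apply: contraTT; rewrite -!leqNgt; apply: le.
apply: proper_card; apply/properP; split.
  by apply/subsetP=> z; rewrite !inE => zx; apply: ltn_trans zx lt.
by exists x; rewrite !inE ?ltnn.
Qed.

Lemma position_bound x : position k x < #|B|.
Proof.
rewrite -cardsT; apply: proper_card; apply/properP; split; first exact: subsetT.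
by exists x; rewrite !inE ?ltnn.
Qed.

Lemma position_bij : bijective (fun x => Ordinal (position_bound x)).
Proof.
apply: inj_card_bij; last by rewrite card_ord.
move=> x y [xy]; apply/eqP/negP => /negP /key_neq[]; by rewrite -position_lt xy ltnn.
Qed.

End Monotone.

(** Elements of equal rank are matched. *)
Lemma order_iso (B U : finType) (k : B -> nat) (k' : U -> nat) :
  injective k -> injective k' -> #|B| = #|U| ->
  exists2 f : B -> U, bijective f & monotone k k' f.
Proof.
move=> ki k'i cBU; have [g gK Kg] := position_bij k'i.
have fb := position_bij ki.
pose f x := g (cast_ord cBU (Ordinal (position_bound k x))).
exists f => [|x y xy].
  have : bijective g by exists (fun y => Ordinal (position_bound k' y)).
  move=> gb; apply: (bij_comp gb); apply: bij_comp fb.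
  by exists (cast_ord (esym cBU)) => z; rewrite ?cast_ordK ?cast_ordKV.
rewrite -position_lt.
have posf z : position k' (f z) = position k z.
  by have /(congr1 val) := Kg (cast_ord cBU (Ordinal (position_bound k z))).
by rewrite !posf position_lt.
Qed.

(** Serves the unordered classes: the permutation is later absorbed by homogeneity. *)
Lemma monotone_reorder (B U : finType) (k : B -> nat) (k' : U -> nat) (f : B -> U) :
  injective k -> injective (fun x => k' (f x)) ->
  exists s : {perm B}, monotone k k' (fun x => f (s x)).
Proof.
move=> ki k'i; have [s sb sm] := @order_iso B B k (fun x => k' (f x)) ki k'i erefl.
by exists (perm (bij_inj sb)) => x y xy; rewrite !permE; apply: sm.
Qed.

(** * The partite lemma *)

Definition fcomp (A B C : finType) (g : {ffun B -> C}) (f : {ffun A -> B}) :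
  {ffun A -> C} := [ffun a => g (f a)].

Lemma fcompA (A B C D : finType) (h : {ffun C -> D}) (g : {ffun B -> C})
    (f : {ffun A -> B}) : fcomp h (fcomp g f) = fcomp (fcomp h g) f.
Proof. by apply/ffunP=> x; rewrite !ffunE. Qed.

Definition agree (K V : finType) (s s' : K -> V) : {set K} := [set i | s i == s' i].

(** Abstracts what the partite lemmas need of the index sets on which tuples may agree; the instance
    used is [edge_closed]. *)
Definition intersection_family (K : finType) (closed : {set K} -> Prop) :=
  [/\ closed setT, closed set0 &
      forall I J, closed I -> closed J -> closed (I :&: J)].

Lemma closed_bigcap (K X : finType) (closed : {set K} -> Prop) (F : X -> {set K}) :
  intersection_family closed -> (forall x, closed (F x)) ->
  closed (\bigcap_x F x).
Proof.
by case=> cT _ cI cF; apply: (big_ind closed) => [//|I J|x _]; [apply: cI|apply: cF].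
Qed.

(** Transversality to the parts over [a], where entries of [s] may also lie outside all these
    parts. *)
Definition separates (K V N : finType) (pi : V -> N) (a : K -> N) (s : K -> V) :=
  forall i j, pi (s i) = a j -> i = j.

Definition partite_ramsey (K V V' : finType) (c : nat) (Q : {set {ffun K -> V}})
    (LL : {set {ffun V -> V'}}) :=
  forall chi : {ffun K -> V'} -> 'I_c,
  exists2 L, L \in LL & exists col, forall q, q \in Q -> chi (fcomp L q) = col.

Section WeakPartite.
Variables (K : finType) (closed : {set K} -> Prop).
Hypothesis closedF : intersection_family closed.

(** The maps L are the lines of the Hales-Jewett cube over Q, and its points are the
    tuples fcomp L q. By the last clause a line meets each point of another line
    inside one of its own tuples; two lines with the same moving coordinates,
    however, may share whole parts of V. *)
Lemma weak_partite (V N : finType) (pi : {ffun V -> N}) (a : {ffun K -> N})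
    (Q : {set {ffun K -> V}}) (c : nat) :
  Q != set0 -> injective a -> (forall q, q \in Q -> fcomp pi q = a) ->
  (forall q q', q \in Q -> q' \in Q -> closed (agree q q')) -> 0 < c ->
  exists (V' : finType) (pi' : {ffun V' -> N}) (LL : {set {ffun V -> V'}}),
  [/\ forall L, L \in LL -> injective L /\ fcomp pi' L = pi,
      partite_ramsey c Q LL,
      forall L L', L \in LL -> L' \in LL -> L != L' -> forall v v',
        L v = L' v' -> pi v = pi v' /\ exists i, pi v = a i,
      forall L L', L \in LL -> L' \in LL -> L != L' -> forall s s' : K -> V,
        separates pi a s -> separates pi a s' ->
        closed [set i | pi (s i) == a i] -> closed [set i | pi (s' i) == a i] ->
        closed (agree s s') ->
        (forall q, q \in Q -> closed (agree s q)) ->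
        (forall q, q \in Q -> closed (agree s' q)) ->
        closed (agree (fun i => L (s i)) (fun i => L' (s' i)))
    & forall L L', L \in LL -> L' \in LL -> L != L' -> forall q, q \in Q ->
        exists2 p, p \in Q & forall v i, L v = L' (q i) -> v = p i].
Proof.
move=> Q0 ai Qa Qcl c0.
have [q0 q0Q] := set0Pn _ Q0.
pose A := {q | q \in Q}.
have [|X HX] := @hales_jewett A 'I_c; first by apply/card_gt0P; exists (Sub q0 q0Q).
(* A moving line has a moving coordinate, so the cube has at least one; [x0] serves to read off the
   part of a point. *)
have [x0 _] : exists x : X, True.
  have [l /existsP[x _] _] := HX (fun _ => Ordinal c0).
  by exists x.
(* The tag keeps apart, for distinct lines, the vertices outside the parts a. *)
pose V' : finType := ({ffun X -> V} * option {ffun X -> option A})%type.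
pose part v := [pick i | pi v == a i].
have partP v i : pi v = a i -> part v = Some i.
  rewrite /part => vi; case: pickP => [j /eqP vj|/(_ i)]; last by rewrite vi eqxx.
  by congr Some; apply: ai; rewrite -vi -vj.
have part_some v i : part v = Some i -> pi v = a i.
  by rewrite /part; case: pickP => // j /eqP-> [->].
have QaE (q : A) i : pi (val q i) = a i.
  by have /ffunP/(_ i) := Qa _ (valP q); rewrite ffunE.
(* The letters are tuples: a vertex of part [i] keeps itself in the moving coordinates of [l] and
   takes the [i]-th entry of the fixed letter in the others. *)
pose emb (l : {ffun X -> option A}) : {ffun V -> V'} := [ffun v =>
  if part v is Some i then
    ([ffun x => if l x is Some q then val q i else v], None)
  else ([ffun=> v], Some l)].
have embS l v i : pi v = a i ->
    emb l v = ([ffun x => if l x is Some q then val q i else v], None).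
  by move=> vi; rewrite ffunE (partP _ _ vi).
have embN l v : part v = None -> emb l v = ([ffun=> v], Some l).
  by move=> vN; rewrite ffunE vN.
pose pi' : {ffun V' -> N} := [ffun w : V' => pi (fst w x0)].
pose LL : {set {ffun V -> V'}} := [set emb l | l in [pred l | moving l]].
have pi'E l : fcomp pi' (emb l) = pi.
  apply/ffunP=> v; rewrite !ffunE.
  case E: (part v) => [i|]; rewrite /= ffunE //.
  by case: (l x0) => [q|//]; rewrite QaE (part_some _ _ E).
have pi'e l v : pi' (emb l v) = pi v.
  by have /ffunP/(_ v) := pi'E l; rewrite [in LHS]ffunE.
have W1 l l' : emb l != emb l' -> forall v v', emb l v = emb l' v' ->
    exists i, pi v = a i /\ pi v' = a i.
  move=> ne v v' E.
  have piE : pi v = pi v' by rewrite -(pi'e l v) E pi'e.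
  case vE: (part v) => [i|].
    by exists i; rewrite -piE; split; apply: part_some.
  case v'E: (part v') => [i|].
    by exists i; rewrite piE; split; apply: part_some.
  by move: E; rewrite !embN // => -[_ ll']; rewrite ll' eqxx in ne.
exists V', pi', LL; split.
- move=> L /imsetP[l]; rewrite inE => /existsP[x /eqP lx] ->{L}; split => // v v' E.
  have piE : pi v = pi v' by rewrite -(pi'e l v) E pi'e.
  case vE: (part v) => [i|].
    have vi := part_some _ _ vE; move: E.
    rewrite (embS l v i vi) (embS l v' i) -?piE // => -[] /ffunP/(_ x).
    by rewrite !ffunE lx.
  have v'E : part v' = None by rewrite /part -piE.
  by move: E; rewrite !embN // => -[] /ffunP/(_ x); rewrite !ffunE.
(* A point of the cube over [Q] is itself a tuple in [V'], and [emb l] sends [q] to the point of [l]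
   at the letter [q]. *)
- move=> chi; pose tup (w : {ffun X -> A}) : {ffun K -> V'} :=
    [ffun i => ([ffun x => val (w x) i], None)].
  have [l mv mono] := HX (fun w => chi (tup w)).
  exists (emb l); first by apply/imsetP; exists l.
  exists (chi (tup (line_point l (Sub q0 q0Q)))) => q qQ.
  rewrite (mono _ (Sub q qQ)); congr chi; apply/ffunP=> i.
  rewrite !ffunE (partP _ i); last by have /ffunP/(_ i) := Qa _ qQ; rewrite ffunE.
  by congr pair; apply/ffunP=> x; rewrite !ffunE; case: (l x).
- move=> L L' /imsetP[l _ ->{L}] /imsetP[l' _ ->{L'}] ne v v' E.
  by have [i [-> ->]] := W1 _ _ ne _ _ E; split=> //; exists i.
- move=> L L' /imsetP[l _ ->{L}] /imsetP[l' _ ->{L'}] ne s s' seps seps' I1 I2 css' csq cs'q.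
  (* The indices at which the two images agree in coordinate [x]. Each such set is closed, and the
     agreement set is their intersection over all [x], cut down to the indices that lie in the
     parts. *)
  pose C x := match l x, l' x with
    | None, None => agree s s'
    | None, Some q => agree s (val q)
    | Some q, None => agree s' (val q)
    | Some q, Some q' => agree (val q) (val q')
    end.
  suff -> : agree (fun i => emb l (s i)) (fun i => emb l' (s' i)) =
      [set i | pi (s i) == a i] :&: [set i | pi (s' i) == a i] :&: \bigcap_x C x.
    have [_ _ cI] := closedF; apply: (cI); first exact: cI.
    apply: closed_bigcap => // x; rewrite /C.
    case: (l x) => [q|]; case: (l' x) => [q'|] //.
    + by apply: Qcl; apply: valP.
    + exact: cs'q (valP q).
    + exact: csq (valP q').
  apply/setP=> i; rewrite !inE; apply/eqP/andP => [E|[]].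
    have [j [sj s'j]] := W1 _ _ ne _ _ E.
    have ij := seps _ _ sj; rewrite -{}ij in sj s'j.
    rewrite sj s'j eqxx; split=> //; apply/bigcapP=> x _.
    move: E; rewrite (embS _ _ i) // (embS _ _ i) // => -[] /ffunP/(_ x).
    rewrite !ffunE /C; case: (l x) => [q|]; case: (l' x) => [q'|] E;
      by rewrite inE ?E // eq_sym.
  case/andP=> /eqP si /eqP s'i /bigcapP H.
  rewrite (embS _ _ i) // (embS _ _ i) //; congr pair; apply/ffunP=> x.
  have := H x isT; rewrite !ffunE /C.
  by case: (l x) => [q|]; case: (l' x) => [q'|]; rewrite inE => /eqP.
move=> L L' /imsetP[l]; rewrite inE => /existsP[x /eqP lx] ->{L} /imsetP[l' _ ->{L'}] ne q qQ.
have qE i : pi (q i) = a i by have /ffunP/(_ i) := Qa _ qQ; rewrite ffunE.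
(* This is the tuple that the image of [q] shows in the moving coordinate [x] of [l]; there [l]
   shows [v] itself. *)
exists (if l' x is Some q' then val q' else q).
  by case: (l' x) => [q'|//]; apply: valP.
move=> v i E; have [j [vj]] := W1 _ _ ne _ _ E; rewrite qE => /ai ij.
rewrite -{}ij in vj.
move: E; rewrite (embS _ _ i) // (embS _ _ i) // => -[] /ffunP/(_ x).
by rewrite !ffunE lx; case: (l' x).
Qed.

End WeakPartite.

(** * Iterated amplification of pictures *)

Section Iteration.
Variables (B K U : finType) (LL : {set {ffun B -> U}}) (Q : {set {ffun K -> B}}).
Variables (c : nat) (Inv : forall P : finType, {ffun B -> P} -> {ffun B -> P} -> Prop).

(** The members of X are copies of B in P, each lying over a target in LL. *)
Definition picture (P : finType) (pi : {ffun P -> U}) (X : {set {ffun B -> P}}) :=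
  (forall x, x \in X -> fcomp pi x \in LL) /\
  (forall x y, x \in X -> y \in X -> Inv x y).

Definition fibre (P : finType) (pi : {ffun P -> U}) (X : {set {ffun B -> P}})
    (u : {ffun K -> U}) : {set {ffun K -> P}} :=
  [set w | [exists x in X, exists q in Q, w == fcomp x q] & fcomp pi w == u].

Lemma fibreP (P : finType) (pi : {ffun P -> U}) (X : {set {ffun B -> P}}) u w :
  reflect (exists x q, [/\ x \in X, q \in Q, w = fcomp x q & fcomp pi w = u])
    (w \in fibre pi X u).
Proof.
rewrite inE; apply: (iffP andP) => [[/exists_inP[x xX /exists_inP[q qQ /eqP->]] /eqP]|].
  by exists x, q.
case=> x [q [xX qQ -> <-]]; split=> //; apply/exists_inP; exists x => //.
by apply/exists_inP; exists q.
Qed.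

(** The initial picture is the disjoint union of one copy of [B] for each target. *)
Definition tagged_copy (l : {ffun B -> U}) : {ffun B -> {ffun B -> U} * B} :=
  [ffun b => (l, b)].

Hypothesis Inv_tagged : forall l l', l \in LL -> l' \in LL ->
  Inv (tagged_copy l) (tagged_copy l').

Hypothesis step : forall (P : finType) (pi : {ffun P -> U}) (X : {set {ffun B -> P}})
    (u : {ffun K -> U}), picture pi X -> fibre pi X u != set0 ->
  exists (P' : finType) (pi' : {ffun P' -> U}) (LL' : {set {ffun P -> P'}}),
  [/\ forall L, L \in LL' -> fcomp pi' L = pi,
      forall L L' x y, L \in LL' -> L' \in LL' -> x \in X -> y \in X ->
        Inv (fcomp L x) (fcomp L' y)
    & partite_ramsey c (fibre pi X u) LL'].

(** One amplification for each tuple [u] of the ground set makes the colour of the tuples over [u]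
    depend on [u] alone. *)
Lemma partite_iteration (us : seq {ffun K -> U}) : 0 < c ->
  exists (P : finType) (pi : {ffun P -> U}) (X : {set {ffun B -> P}}),
  picture pi X /\
  forall chi : {ffun K -> P} -> 'I_c,
  exists (xs : {ffun B -> U} -> {ffun B -> P}) (g : {ffun K -> U} -> 'I_c),
  (forall l, l \in LL -> xs l \in X /\ fcomp pi (xs l) = l) /\
  forall l q, l \in LL -> q \in Q -> fcomp l q \in us ->
    chi (fcomp (xs l) q) = g (fcomp l q).
Proof.
move=> c0; elim: us => [|u us [P [pi [X [pic Hchi]]]]].
  pose pi : {ffun {ffun B -> U} * B -> U} := [ffun z : {ffun B -> U} * B => fst z (snd z)].
  have piE l : fcomp pi (tagged_copy l) = l by apply/ffunP=> b; rewrite !ffunE.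
  exists ({ffun B -> U} * B)%type, pi, [set tagged_copy l | l in LL]; split.
    split=> [x /imsetP[l lL ->]|x y /imsetP[l lL ->] /imsetP[l' lL' ->]].
      by rewrite piE.
    exact: Inv_tagged.
  move=> chi; exists tagged_copy, (fun=> Ordinal c0); split=> // l lL.
  by rewrite piE; split=> //; apply: imset_f.
have [fib0|fibn0] := eqVneq (fibre pi X u) set0.
  exists P, pi, X; split=> // chi; have [xs [g [Hxs Hg]]] := Hchi chi.
  exists xs, g; split=> // l q lL qQ; rewrite inE => /orP[/eqP lqu|]; last exact: Hg.
  have [xX pix] := Hxs l lL; have : fcomp (xs l) q \in fibre pi X u.
    by apply/fibreP; exists (xs l), q; rewrite fcompA pix.
  by rewrite fib0 inE.
have [P' [pi' [LL' [piL InvL ram]]]] := step pic fibn0.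
exists P', pi', [set fcomp z.1 z.2 | z in setX LL' X]; split.
  split=> [x /imsetP[[L x0] /setXP[LL0 xX] ->]|].
    by rewrite fcompA piL //; apply: pic.1.
  move=> x y /imsetP[[L x0] /setXP[LL0 xX] ->] /imsetP[[L' y0] /setXP[LL0' yX] ->].
  exact: InvL.
move=> chi; have [L LL0 [col Hcol]] := ram chi.
(* The last amplification is resolved first: the colouring is pulled back along [L] and handed to
   the earlier picture. *)
have [xs [g [Hxs Hg]]] := Hchi (fun w => chi (fcomp L w)).
exists (fun l => fcomp L (xs l)), (fun v => if v == u then col else g v); split.
  move=> l lL; have [xX pix] := Hxs l lL; rewrite fcompA piL //; split=> //.
  by apply/imsetP; exists (L, xs l) => //; apply/setXP.
move=> l q lL qQ; have [xX pix] := Hxs l lL.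
rewrite -fcompA inE; case: eqP => [lqu _|_ /= lqus]; last exact: Hg.
apply: Hcol; apply/fibreP; exists (xs l), q; split=> //.
by rewrite fcompA pix.
Qed.

End Iteration.

Section StrongPartite.
Variables (K : finType) (closed : {set K} -> Prop).
Hypothesis closedF : intersection_family closed.

(** The two clauses together determine the intersection of the copies exactly: it is the part [I] of
    a tuple of either copy. *)
Definition meet_in_tuple (V P : finType) (Q : {set {ffun K -> V}})
    (x y : {ffun V -> P}) :=
  exists p p' I, [/\ p \in Q, p' \in Q, closed I,
    forall i, i \in I -> x (p i) = y (p' i) &
    forall v v', x v = y v' -> exists i, [/\ i \in I, v = p i & v' = p' i]].

(** The iteration runs over the cube [U] with its lines as targets, and each step is again
    [weak_partite]. The invariant is that two copies are equal or meet in a tuple. *)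
Lemma strong_partite (V N : finType) (pi : {ffun V -> N}) (a : {ffun K -> N})
    (Q : {set {ffun K -> V}}) (c : nat) :
  Q != set0 -> injective a -> (forall q, q \in Q -> fcomp pi q = a) ->
  (forall q q', q \in Q -> q' \in Q -> closed (agree q q')) -> 0 < c ->
  exists (V' : finType) (pi' : {ffun V' -> N}) (LL : {set {ffun V -> V'}}),
  [/\ forall L, L \in LL -> injective L /\ fcomp pi' L = pi,
      partite_ramsey c Q LL
    & forall L L', L \in LL -> L' \in LL -> L != L' -> meet_in_tuple Q L L'].
Proof.
move=> Q0 ai Qa Qcl c0.
have [q0 q0Q] := set0Pn _ Q0.
have [U [piU [GG [GG1 ramG _ G2 G3]]]] := weak_partite closedF Q0 ai Qa Qcl c0.
have QaE q i : q \in Q -> pi (q i) = a i.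
  by move=> qQ; have /ffunP/(_ i) := Qa _ qQ; rewrite ffunE.
have piGE l v : l \in GG -> piU (l v) = pi v.
  by move=> /GG1[_ /ffunP/(_ v)]; rewrite ffunE.
have [cT c_0 cI] := closedF.
have sepQ q : q \in Q -> separates pi a q.
  by move=> qQ i j; rewrite QaE // => /ai.
(* Under the invariant, agreement at [i] forces [i] into [I] and makes both tuples agree there with
   the two tuples of the intersection. *)
have agrI (P : finType) (x z : {ffun V -> P}) p r : x = z \/ meet_in_tuple Q x z ->
    p \in Q -> r \in Q -> (forall v v', x v = z v' -> pi v = pi v') -> injective x ->
    closed (agree (fun i => x (p i)) (fun i => z (r i))).
  move=> xz pQ rQ xzpi xi; case: xz => [xz|[p1 [p2 [I [p1Q p2Q cI1 HI xzI]]]]].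
    suff -> : agree (fun i => x (p i)) (fun i => z (r i)) = agree p r by apply: Qcl.
    by apply/setP=> i; rewrite !inE -xz (inj_eq xi).
  suff -> : agree (fun i => x (p i)) (fun i => z (r i)) =
      I :&: agree p p1 :&: agree r p2 by apply: (cI); [apply: cI|]; auto.
  apply/setP=> i; rewrite !inE; apply/eqP/andP => [E|[/andP[iI /eqP-> /eqP->]]].
    have [j [jI pj rj]] := xzI _ _ E.
    have ij : i = j by apply: ai; rewrite -(QaE p) // pj QaE.
    by rewrite -ij in jI pj rj; rewrite jI pj rj !eqxx.
  exact: HI.
pose Inv (P : finType) (x y : {ffun V -> P}) := x = y \/ meet_in_tuple Q x y.
have [|P pi0 X u [pic1 pic2] fib0|P [piP [X [[pic1 pic2] Hchi]]]] :=
  @partite_iteration V K U GG Q c Inv _ _ (enum {: {ffun K -> U}}) c0.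
(* Distinct tagged copies are disjoint, so the empty index set works with any tuple. *)
- move=> l l' _ _; have [->|ne] := eqVneq l l'; first by left.
  right; exists q0, q0, set0; split=> // [i|v v']; first by rewrite inE.
  by rewrite !ffunE => -[/eqP]; rewrite (negPf ne).
- have piX x v : x \in X -> piU (pi0 (x v)) = pi v.
    by move=> /pic1 xG; rewrite -(piGE _ v xG) ffunE.
  have Xinj x : x \in X -> injective x.
    move=> /pic1 /GG1[xi _] v v' E; apply: xi; by rewrite !ffunE E.
  have [w0 /fibreP[x0 [q [x0X qQ -> uE]]]] := set0Pn _ fib0.
  move: uE; rewrite fcompA => /esym; move: (pic1 _ x0X).
  move: (fcomp pi0 x0) => l lG uE.
  have liQ p : p \in Q -> [set i | pi (p i) == a i] = setT.
    by move=> pQ; apply/setP=> i; rewrite !inE QaE ?eqxx.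
  (* [u] is a tuple of the line [l]. The line below [x] meets it inside one of its own tuples, so
     what [x] has over [u] lies in a single tuple of [x], on a closed index set. *)
  have shadow x : x \in X -> exists p, [/\ p \in Q,
      closed [set i | pi0 (x (p i)) == u i] &
      forall v i, pi0 (x v) = u i -> v = p i].
    move=> xX; have mG := pic1 _ xX; have [li _] := GG1 _ lG.
    have mE v : fcomp pi0 x v = pi0 (x v) by rewrite ffunE.
    have uiE i : u i = l (q i) by rewrite uE ffunE.
    have [ml|nml] := eqVneq (fcomp pi0 x) l.
      exists q; split=> // [|v i]; last by rewrite uiE -mE ml => /li.
      by rewrite (_ : [set i | _] = setT) //; apply/setP=> i; rewrite !inE uiE -mE ml eqxx.
    have [p pQ Hp] := G3 _ _ mG lG nml _ qQ.
    exists p; split=> // [|v i]; last by rewrite uiE -mE; apply: Hp.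
    rewrite (_ : [set i | _] = agree (fun i => fcomp pi0 x (p i)) (fun i => l (q i))).
      by apply: (G2) => //; rewrite ?liQ //; auto.
    by apply/setP=> i; rewrite !inE uiE mE.
  have ui : injective u.
    by move=> i j; rewrite uE !ffunE => /(GG1 _ lG).1 E; apply: ai; rewrite -!(QaE q) // E.
  have agrX x z p r : x \in X -> z \in X -> p \in Q -> r \in Q ->
      closed (agree (fun i => x (p i)) (fun i => z (r i))).
    move=> xX zX pQ rQ; apply: (agrI) => //; [exact: pic2| |exact: Xinj].
    by move=> v v' E; rewrite -(piX x) // E piX.
  have agrF (f : K -> P) x p : agree f (fcomp x p) = agree f (fun i => x (p i)).
    by apply/setP=> i; rewrite !inE ffunE.
  have [||P' [pi' [LL' [L1 ramL W1 W2 _]]]] :=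
      @weak_partite K closed closedF P U pi0 u (fibre Q pi0 X u) c fib0 ui _ _ c0.
  + by move=> w /fibreP[x [p []]].
  + move=> w w' /fibreP[x [p [xX pQ -> _]]] /fibreP[z [r [zX rQ -> _]]].
    rewrite agrF (_ : agree _ _ = agree (fun i => x (p i)) (fun i => z (r i))).
      exact: agrX.
    by apply/setP=> i; rewrite !inE ffunE.
  exists P', pi', LL'; split=> // [L /L1[]//|L L' x y LL0 L'L0 xX yX].
  have [Li _] := L1 _ LL0.
  (* Within one [L] the invariant is inherited. For distinct [L] and [L'] the copies can meet only
     over [u], hence inside their shadows. *)
  have [<-|nL] := eqVneq L L'.
    have [->|[p [p' [I [pQ p'Q cI1 HI xyI]]]]] := pic2 _ _ xX yX; first by left.
    right; exists p, p', I; split=> // [i iI|v v']; rewrite !ffunE.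
      by rewrite HI.
    by move/Li; apply: xyI.
  right; have [p [pQ cp Hp]] := shadow _ xX; have [p' [p'Q cp' Hp']] := shadow _ yX.
  exists p, p', (agree (fun i => L (x (p i))) (fun i => L' (y (p' i)))); split=> //.
  - have sep z r : z \in X -> r \in Q -> separates pi0 u (fun i => z (r i)).
      move=> zX rQ i j E; apply: ai; rewrite -(QaE r) // -(piX z) // E uE ffunE.
      by rewrite piGE // QaE.
    apply: W2 => //; auto.
    + by move=> w /fibreP[z [r [zX rQ -> _]]]; rewrite agrF; apply: agrX.
    + by move=> w /fibreP[z [r [zX rQ -> _]]]; rewrite agrF; apply: agrX.
  - by move=> i; rewrite inE !ffunE => /eqP.
  - move=> v v'; rewrite !ffunE => E.
    have [piE [i vi]] := W1 _ _ LL0 L'L0 nL _ _ E.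
    have vp := Hp _ _ vi; have v'p := Hp' v' i; rewrite -piE in v'p.
    exists i; split; [rewrite inE; apply/eqP| |]; rewrite -?vp -?v'p //.
- exists P, (fcomp piU piP), X; split.
  + move=> x /[dup] xX /pic1 xG; split.
      by move=> v v' E; apply: (GG1 _ xG).1; rewrite !ffunE E.
    by rewrite -fcompA (GG1 _ xG).2.
  + move=> chi; have [xs [g [Hxs Hg]]] := Hchi chi.
    (* The colour of a tuple of [xs l] is now that of its projection, so a monochromatic line of the
       cube is enough. *)
    have [l lG [col Hcol]] := ramG g.
    exists (xs l); first exact: (Hxs _ lG).1.
    by exists col => q qQ; rewrite Hg ?mem_enum //; apply: Hcol.
  + move=> x y xX yX nxy; have [xy|//] := pic2 _ _ xX yX.
    by rewrite xy eqxx in nxy.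
Qed.

End StrongPartite.

(** * The ordered strong class *)

(** For [s = t] these are the strong embeddings, for [s = r] (the size of the
    edges) the induced ones. *)
Definition embedding (s : nat) (B U : finType) (E : {set {set B}})
    (E' : {set {set U}}) (f : B -> U) : Prop :=
  [/\ injective f, forall e, e \in E -> f @: e \in E' &
      forall e, e \in E' -> s <= #|e :&: f @: setT| ->
        exists2 e0, e0 \in E & e = f @: e0].

Definition steiner_edges (r t : nat) (B : finType) (E : {set {set B}}) : Prop :=
  (forall e, e \in E -> #|e| = r) /\
  (forall e e', e \in E -> e' \in E -> t <= #|e :&: e'| -> e = e').

Definition embeddingb (s : nat) (B U : finType) (E : {set {set B}})
    (E' : {set {set U}}) (f : B -> U) : bool :=
  [&& injectiveb f, [forall e in E, f @: e \in E'] &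
      [forall e in E', (s <= #|e :&: f @: setT|) ==>
        [exists e0 in E, e == f @: e0]]].

Lemma embeddingP s (B U : finType) (E : {set {set B}}) (E' : {set {set U}}) f :
  reflect (embedding s E E' f) (embeddingb s E E' f).
Proof.
apply: (iffP and3P) => -[fi H1 H2]; split.
- exact/injectiveP.
- by move=> e eE; apply: (forall_inP H1).
- move=> e eE se; have /implyP/(_ se)/exists_inP[e0 e0E /eqP] := forall_inP H2 e eE.
  by exists e0.
- exact/injectiveP.
- by apply/forall_inP.
- apply/forall_inP => e eE; apply/implyP => /(H2 e eE)[e0 e0E ->].
  by apply/exists_inP; exists e0.
Qed.

Definition monotoneb (B U : finType) (k : B -> nat) (k' : U -> nat) (f : B -> U) :=
  [forall x, forall y, (k x < k y) ==> (k' (f x) < k' (f y))].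

Lemma monotoneP (B U : finType) (k : B -> nat) (k' : U -> nat) f :
  reflect (monotone k k' f) (monotoneb k k' f).
Proof.
apply: (iffP forallP) => [H x y|H x].
  by have /forallP/(_ y)/implyP := H x.
by apply/forallP=> y; apply/implyP/H.
Qed.

Lemma eq_embedding s (B U : finType) (E : {set {set B}}) (E' : {set {set U}}) f g :
  f =1 g -> embedding s E E' f -> embedding s E E' g.
Proof.
move=> fg; have im (A : {set B}) : g @: A = f @: A by apply: eq_imset => x; rewrite fg.
case=> fi H1 H2; split=> [x y|e|e]; rewrite -?fg ?im; [exact: fi|exact: H1|].
move=> eE /(H2 e eE)[e0 e0E ->]; by exists e0 => //; rewrite im.
Qed.

Lemma fcomp_imset (A B C : finType) (g : {ffun B -> C}) (f : {ffun A -> B})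
  (e : {set A}) : fcomp g f @: e = g @: (f @: e).
Proof. by rewrite -imset_comp; apply: eq_imset => x; rewrite ffunE. Qed.

Section Core.
Variables (r t c : nat) (B K : finType) (EB : {set {set B}}) (EK : {set {set K}}).
Variables (kB : B -> nat) (kK : K -> nat).
Hypotheses (t0 : 0 < t) (c0 : 0 < c) (kBi : injective kB)
  (kKi : injective kK).
Hypothesis SB : steiner_edges r t EB.

(** The vertex sets of strong subsystems of [(K, EK)]. *)
Definition edge_closed (I : {set K}) : Prop :=
  forall e, e \in EK -> t <= #|e :&: I| -> e \subset I.

Lemma edge_closed_family : intersection_family edge_closed.
Proof.
split=> [e _ _|e _|I J cI cJ e eE le]; first exact: subsetT.
  by rewrite setI0 cards0 leqNgt t0.
rewrite subsetI cI ?cJ //; apply: leq_trans le _; apply: subset_leq_card.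
  by rewrite setIS // subsetIr.
by rewrite setIS // subsetIl.
Qed.

(** This makes y strong in the union of the edge images, and that union a
    Steiner system. *)
Definition compatible (P : finType) (x y : {ffun B -> P}) : Prop :=
  forall e, e \in EB -> t <= #|(x @: e) :&: (y @: setT)| ->
  exists2 e', e' \in EB & x @: e = y @: e'.

Lemma compatible_comp (P P' : finType) (L : {ffun P -> P'}) (x y : {ffun B -> P}) :
  injective L -> compatible x y -> compatible (fcomp L x) (fcomp L y).
Proof.
move=> Li xy e eE; rewrite !fcomp_imset -imsetI; last by move=> ? ? _ _; apply: Li.
rewrite card_imset // => /(xy e eE)[e' e'E ->]; exists e' => //.
by rewrite fcomp_imset.
Qed.

(** The targets are all monotone maps from [B] to ['I_n], and [strong_partite] supplies the steps.
    Compatibility of all copies is the invariant. *)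
Theorem ordered_strong_ramsey :
  exists (P : finType) (EP : {set {set P}}) (kP : P -> nat),
  [/\ steiner_edges r t EP, injective kP &
      forall chi : {ffun K -> P} -> 'I_c, exists x : {ffun B -> P},
      [/\ embedding t EB EP x, monotone kB kP x &
          exists col, forall q : {ffun K -> B}, embedding t EK EB q ->
            monotone kK kB q -> chi (fcomp x q) = col]].
Proof.
pose Q : {set {ffun K -> B}} := [set q : {ffun K -> B} |
  embeddingb t EK EB q && monotoneb kK kB q].
have QP q : q \in Q -> embedding t EK EB q /\ monotone kK kB q.
  by rewrite inE => /andP[/embeddingP ? /monotoneP ?].
have [n Hn] := ramsey #|K| c #|B|.
pose LL : {set {ffun B -> 'I_n}} := [set l : {ffun B -> 'I_n} |
  monotoneb kB (@nat_of_ord n) l].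
have LLP l : l \in LL -> monotone kB (@nat_of_ord n) l.
  by rewrite inE => /monotoneP.
have LLi l : l \in LL -> injective l by move=> /LLP; apply: monotone_inj.
have [||P [pi [X [[pic1 pic2] Hchi]]]] :=
  @partite_iteration B K 'I_n LL Q c compatible _ _ (enum {: {ffun K -> 'I_n}}) c0.
- move=> l l' lL l'L e eE; have [<-|nl] := eqVneq l l'; first by exists e.
  suff -> : tagged_copy l @: e :&: tagged_copy l' @: setT = set0.
    by rewrite cards0 leqNgt t0.
  apply/setP=> z; rewrite !inE; apply/negP=> /andP[/imsetP[b _ ->] /imsetP[b' _]].
  by rewrite !ffunE => -[/eqP]; rewrite (negPf nl).
- move=> P pi X u [pic1 pic2] fib0.
  have Xi x : x \in X -> injective x.
    by move=> /pic1 /LLi xi v v' E; apply: xi; rewrite !ffunE E.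
  have ui : injective u.
    have [w /fibreP[x [q [xX /QP[_ mq] -> <-]]]] := set0Pn _ fib0.
    move=> i j; rewrite fcompA ffunE [RHS]ffunE => /(LLi _ (pic1 _ xX)).
    exact: (monotone_inj kKi mq).
  (* Compatibility carries an edge [f] with [t] agreeing points to an edge of the second copy, and
     strength of [p'] pulls that back to an edge [f']. Both have the same image under the injective
     [u], so [f = f'] and the tuples agree on all of [f]. *)
  have agrF w w' : w \in fibre Q pi X u -> w' \in fibre Q pi X u ->
      edge_closed (agree w w').
    move=> /fibreP[x [p [xX /QP[[pi_ p1 p2] _] -> pu]]].
    move=> /fibreP[x' [p' [x'X /QP[[p'i p'1 p'2] _] -> p'u]]] f fE le.
    have sub : fcomp x p @: (f :&: agree (fcomp x p) (fcomp x' p')) \subset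
        (x @: (p @: f)) :&: (x' @: (p' @: setT)).
      apply/subsetP=> z /imsetP[i]; rewrite !inE => /andP[iF /eqP E] ->{z}.
      by rewrite {2}E -!fcomp_imset !imset_f.
    have wi : injective (fcomp x p).
      by move=> i j; rewrite !ffunE => /(Xi _ xX) /pi_.
    have le1 : t <= #|(x @: (p @: f)) :&: (x' @: (p' @: setT))|.
      by apply: leq_trans le _; rewrite -(card_imset _ wi); apply: subset_leq_card.
    have [|e' e'E xe] := pic2 _ _ xX x'X _ (p1 _ fE).
      apply: leq_trans le1 _; apply: subset_leq_card; apply: setIS.
      by apply: imsetS; apply: subsetT.
    have [|f' f'E ef'] := p'2 _ e'E.
      rewrite -(card_imset _ (Xi _ x'X)) imsetI -?xe // => ? ? _ _; exact: Xi.
    have wf : fcomp x p @: f = fcomp x' p' @: f'.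
      by rewrite !fcomp_imset xe ef'.
    have uf : u @: f = u @: f' by rewrite -{1}pu -p'u fcomp_imset [RHS]fcomp_imset wf.
    have {}uf : f = f' by apply: (imset_inj ui).
    apply/subsetP=> i iF; rewrite inE.
    have : fcomp x p i \in fcomp x' p' @: f' by rewrite -wf imset_f.
    case/imsetP=> j _ E; suff ij : i = j by rewrite {2}ij E.
    by apply: ui; rewrite -{1}pu -p'u ffunE [RHS]ffunE E.
  have [|P' [pi' [LL' [L1 ramL W]]]] :=
      @strong_partite K edge_closed edge_closed_family P 'I_n pi u
        (fibre Q pi X u) c fib0 ui _ agrF c0.
    by move=> w /fibreP[x [p []]].
  exists P', pi', LL'; split=> // [L /L1[]//|L L' x y LL0 L'L0 xX yX].
  have [<-|nL] := eqVneq L L'.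
    by apply: compatible_comp; [apply: (L1 _ LL0).1|apply: pic2].
  have [q1 [q2 [I [q1F q2F cI q12 HI]]]] := W _ _ LL0 L'L0 nL.
  case/fibreP: q1F q12 HI => x1 [p1 [x1X /QP[[p1i p11 p12] _] -> _]].
  case/fibreP: q2F => x2 [p2 [x2X /QP[[p2i p21 p22] _] -> _]] q12 HI.
  have [Li _] := L1 _ LL0; have [L'i _] := L1 _ L'L0.
  (* The edge is followed from [x] to [x1], back to an edge [f] of [K] inside [I], across to [x2] by
     the agreement on [I], and from [x2] to [y]. *)
  move=> e eE le.
  have sub : (fcomp L x @: e) :&: (fcomp L' y @: setT) \subset
      L @: ((x @: e) :&: (x1 @: (p1 @: I))).
    apply/subsetP=> z; rewrite !inE => /andP[/imsetP[b be ->]].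
    rewrite !ffunE => /imsetP[b' _]; rewrite ffunE => /HI[i [iI xb yb']].
    by rewrite imset_f // inE imset_f //= xb -fcomp_imset imset_f.
  have le1 : t <= #|(x @: e) :&: (x1 @: (p1 @: I))|.
    by rewrite -(card_imset _ Li); apply: leq_trans le (subset_leq_card sub).
  have [|e1 e1E xe1] := pic2 _ _ xX x1X _ eE.
    apply: leq_trans le1 _; apply: subset_leq_card; apply: setIS.
    by apply: imsetS; apply: subsetT.
  have le2 : t <= #|e1 :&: p1 @: I|.
    rewrite -(card_imset _ (Xi _ x1X)) imsetI -?xe1 // => ? ? _ _; exact: Xi.
  have [|f fE e1f] := p12 _ e1E.
    apply: leq_trans le2 _; apply: subset_leq_card; apply: setIS.
    by apply: imsetS; apply: subsetT.
  have fI : f \subset I.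
    apply: cI => //; rewrite -(card_imset _ p1i) imsetI -?e1f // => ? ? _ _; exact: p1i.
  have E12 : fcomp L x @: e = fcomp L' x2 @: (p2 @: f).
    rewrite fcomp_imset xe1 e1f -!fcomp_imset; apply: eq_in_imset => i iF.
    by have := q12 i (subsetP fI _ iF); rewrite !ffunE.
  have [|e' e'E xe'] := pic2 _ _ x2X yX _ (p21 _ fE).
    rewrite -(card_imset _ L'i) imsetI; last by move=> ? ? _ _; apply: L'i.
    by rewrite -!(fcomp_imset L') -E12.
  by exists e' => //; rewrite E12 !fcomp_imset xe'.
pose EP := [set x @: e | x : {ffun B -> P} in X, e : {set B} in EB].
(* Vertices are ordered by projection, with ties broken arbitrarily; every copy in [X] is then
   monotone. *)
pose kP (v : P) := pi v * #|P| + enum_rank v.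
have Xi x : x \in X -> injective x.
  by move=> /pic1 /LLi xi v v' E; apply: xi; rewrite !ffunE E.
have EPX x y e e' : x \in X -> y \in X -> e \in EB -> e' \in EB ->
    t <= #|x @: e :&: y @: e'| -> x @: e = y @: e'.
  move=> xX yX eE e'E le; have [|e1 e1E xe] := pic2 _ _ xX yX _ eE.
    apply: leq_trans le _; apply: subset_leq_card; apply: setIS.
    by apply: imsetS; apply: subsetT.
  rewrite xe; suff -> : e1 = e' by [].
  apply: SB.2 => //.
  rewrite -(card_imset _ (Xi _ yX)) imsetI -?xe // => ? ? _ _; exact: Xi.
exists P, EP, kP; split.
- split=> [_ /imset2P[x e xX eE ->]|].
    by rewrite card_imset; [apply: SB.1|apply: Xi].
  by move=> _ _ /imset2P[x e xX eE ->] /imset2P[y e' yX e'E ->]; apply: EPX.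
- move=> v v' /(congr1 (modn^~ #|P|)); rewrite /kP !modnMDl !modn_small //.
  by move/val_inj/enum_rank_inj.
move=> chi; have [xs [g [Hxs Hg]]] := Hchi chi.
(* A set receives the colour of its increasing enumeration by [K]; the default only concerns sets of
   another size. *)
pose col0 S := if [pick u : {ffun K -> 'I_n} |
    monotoneb kK (@nat_of_ord n) u && (u @: setT == S)] is Some u
  then g u else Ordinal c0.
have [M [col [cM HM]]] := Hn col0.
have [||f fb fm] := @order_iso B {x | x \in M} kB (fun x => val x) kBi _ _.
- by move=> y y' /val_inj /val_inj.
- by rewrite card_sig -cM; apply: eq_card => y; rewrite !inE.
pose l : {ffun B -> 'I_n} := [ffun b => val (f b)].
have lL : l \in LL.
  by rewrite inE; apply/monotoneP=> b b' bb'; rewrite !ffunE; apply: fm.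
have [xX pix] := Hxs l lL; exists (xs l); split.
- split; first exact: Xi.
    by move=> e eE; apply/imset2P; exists (xs l) e.
  by move=> _ /imset2P[y e yX eE ->]; apply: pic2.
- have piE b : pi (xs l b) = l b by rewrite -{2}pix ffunE.
  move=> b b' /(LLP _ lL) lt; rewrite /kP !piE.
  apply: leq_trans (leq_addr _ _); apply: (@leq_trans ((l b).+1 * #|P|)).
    by rewrite mulSn addnC ltn_add2r ltn_ord.
  by rewrite leq_mul2r lt orbT.
exists col => q eq mq; have qQ : q \in Q.
  by rewrite inE; apply/andP; split; [apply/embeddingP|apply/monotoneP].
rewrite Hg ?mem_enum //.
have mlq : monotone kK (@nat_of_ord n) (fcomp l q).
  by move=> i j /mq /(LLP _ lL); rewrite !ffunE.
have <- : col0 (fcomp l q @: setT) = col.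
  apply: HM; last by rewrite card_imset ?cardsT //; apply: monotone_inj mlq.
  by apply/subsetP=> _ /imsetP[i _ ->]; rewrite !ffunE; apply: valP.
rewrite /col0; case: pickP => [u /andP[/monotoneP mu /eqP uE]|/(_ (fcomp l q))].
  by congr g; apply/ffunP/(monotone_imset_inj kKi mlq mu); rewrite uE.
by rewrite eqxx andbT => /monotoneP[].
Qed.

End Core.

(** * Copies as embeddings *)

Definition edges_on (T : finType) (G : hypergraph T) : {set {set vertex G}} :=
  [set e : {set vertex G} | val @: e \in eset G].

Definition hrestrict (r : nat) (T : finType) (H : hypergraph T) (W : {set T}) :=
  Hypergraph W (eset H :&: [set e : {set T} | e \subset W & #|e| == r]).

Lemma imset_val_preim (T : finType) (G : hypergraph T) (e : {set T}) :
  e \subset vset G -> val @: (val @^-1: e : {set vertex G}) = e.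
Proof.
move=> eG; apply/setP=> x; apply/imsetP/idP => [[y]|xe].
  by rewrite inE => ye ->.
by exists (Sub x (subsetP eG x xe)); rewrite ?inE SubK.
Qed.

Lemma steiner_eset r t (T : finType) (G : hypergraph T) :
  steiner r t G -> steiner_edges r t (eset G).
Proof.
case=> rG sG; split=> [e /rG[]//|e e' eG e'G].
case/exists_subset_card=> S; rewrite subsetI => /andP[Se Se'] cS.
by apply: (sG S) => //; apply: subset_trans Se (rG _ eG).1.
Qed.

Lemma steiner_edges_on r t (T : finType) (G : hypergraph T) :
  steiner r t G -> steiner_edges r t (edges_on G).
Proof.
move/steiner_eset=> [sz un]; split=> [e|e e']; rewrite !inE.
  by move/sz; rewrite card_imset //; apply: val_inj.
move=> eG e'G le; apply: (imset_inj val_inj); apply: un => //.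
by rewrite -imsetI ?card_imset //; [apply: val_inj|move=> ? ? _ _; apply: val_inj].
Qed.

Lemma steiner_full r t (B : finType) (E : {set {set B}}) :
  steiner_edges r t E -> steiner r t (Hypergraph setT E).
Proof.
case=> sz un; split=> [e eE|S _ cS e e' eE e'E Se Se'].
  by rewrite subsetT sz.
by apply: un => //; rewrite -cS; apply: subset_leq_card; rewrite subsetI Se.
Qed.

(** An edge with [r] points in [G] has all its points there. The weak classes thus become the strong
    case with threshold [r]. *)
Lemma induced_strongly r (T : finType) (G H : hypergraph T) :
  Defs.rgraph r H -> induced r G H -> strongly_induced r r G H.
Proof.
move=> rH [sGH EG]; split=> // e; rewrite inE => /andP[neG eH].
rewrite ltnNge; apply: contra neG => le; rewrite EG !inE eH (rH e eH).2 eqxx andbT.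
have /eqP <- : e :&: vset G == e by rewrite eqEcard subsetIl (rH e eH).2.
exact: subsetIr.
Qed.

Section HypergraphCopy.
Variables (r s : nat) (T U : finType) (F : hypergraph T) (H : hypergraph U).
Hypotheses (rH : Defs.rgraph r H) (sr : s <= r).

Lemma embedding_of_copy (X : hypergraph U) (phi : vertex X -> vertex F) :
  strongly_induced r s X H -> is_iso phi ->
  exists f : vertex F -> U, [/\ forall x, val x = f (phi x),
    f @: setT = vset X, X = hrestrict r H (vset X) &
    embedding s (edges_on F) (eset H) f].
Proof.
move=> [[sXH EX] strX] [[psi phiK psiK] iso].
pose f v := val (psi v).
have im (e : {set vertex F}) : f @: e = val @: (psi @: e) by rewrite -imset_comp.
have imT : f @: setT = vset X.
  apply/setP=> x; apply/imsetP/idP => [[v _ ->]|xX]; first exact: valP.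
  by exists (phi (Sub x xX)); rewrite ?inE // /f phiK SubK.
exists f; split=> //.
- by move=> x; rewrite /f phiK.
- by case: X {phi strX f im imT psi phiK psiK iso} sXH EX => V E /= _ ->.
have psi_phi (e : {set vertex F}) : phi @: (psi @: e) = e.
  by rewrite -imset_comp -[RHS]imset_id; apply: eq_imset => x /=; rewrite psiK.
split.
- by move=> v w /val_inj /(can_inj psiK).
- move=> e; rewrite inE im => eF.
  have : val @: (psi @: e) \in eset X by rewrite iso psi_phi.
  by rewrite EX inE => /andP[].
move=> e eH le; have eX : e \in eset X.
  apply: contraLR le => neX; rewrite -ltnNge imT; apply: strX.
  by rewrite inE neX.
have eV : e \subset vset X by move: eX; rewrite EX !inE => /and3P[].
exists (phi @: (val @^-1: e : {set vertex X})); first by rewrite inE -iso imset_val_preim.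
by rewrite im -imset_comp -{1}(imset_val_preim eV) -imset_comp; apply: eq_imset => x /=;
  rewrite phiK.
Qed.

Lemma copy_of_embedding (f : vertex F -> U) :
  (forall v, f v \in vset H) -> embedding s (edges_on F) (eset H) f ->
  strongly_induced r s (hrestrict r H (f @: setT)) H /\
  exists phi : vertex (hrestrict r H (f @: setT)) -> vertex F,
    is_iso phi /\ forall x, val x = f (phi x).
Proof.
move=> fV [fi f1 f2]; set X := hrestrict r H (f @: setT).
have fXV v : f v \in vset X by rewrite imset_f.
have eX e : e \in eset H -> s <= #|e :&: vset X| -> e \in eset X.
  move=> eH le; have [e0 e0F E] := f2 e eH le.
  by rewrite !inE eH (rH eH).2 eqxx E imsetS ?subsetT.
split.
  split; first by split=> //; apply/subsetP=> _ /imsetP[v _ ->].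
  by move=> e; rewrite inE ltnNge => /andP[neX eH]; apply: contra neX; apply: eX.
pose psi v : vertex X := Sub (f v) (fXV v).
have psii : injective psi by move=> v w /(congr1 val); rewrite !SubK => /fi.
have psi_onto x : exists v, psi v = x.
  have /imsetP[v _ E] := valP x; exists v; apply: val_inj; by rewrite SubK.
have [phi psiK phiK] : bijective psi.
  apply: inj_card_bij => //; rewrite -(card_imset _ psii) ; apply: subset_leq_card.
  by apply/subsetP=> x _; have [v <-] := psi_onto x; apply: imset_f.
have valE x : val x = f (phi x) by rewrite -{1}(phiK x) SubK.
exists phi; split=> //; split; first by exists psi.
move=> e; rewrite (_ : val @: e = f @: (phi @: e)); last first.
  by rewrite -imset_comp; apply: eq_imset.
have -> : (val @: (phi @: e) \in eset F) = (phi @: e \in edges_on F) by rewrite inE.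
apply/idP/idP => [|eF].
  rewrite !inE => /andP[eH /andP[sub /eqP ce]]; have [|e0 e0F E] := f2 _ eH.
    by rewrite (setIidPl sub) ce.
  by move: e0F; rewrite inE -(imset_inj fi E).
have eH := f1 _ eF.
by rewrite !inE eH (rH eH).2 eqxx imsetS ?subsetT.
Qed.

End HypergraphCopy.

(** The empty set is a dummy value, read only under [is_ordered]. *)
Definition ordr (C : steiner_class) (T : finType) : object C T -> {set T * T} :=
  match C return object C T -> {set T * T} with
  | Weak | Strong => fun G => set0
  | WeakOrd | StrongOrd => fun G : ohypergraph T => vord G
  end.

Definition ohrestrict (r : nat) (T : finType) (H : ohypergraph T) (W : {set T}) :=
  OHypergraph (hrestrict r H W) (vord H :&: setX W W).

Definition restrict (r : nat) (C : steiner_class) (T : finType) :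
    object C T -> {set T} -> object C T :=
  match C return object C T -> {set T} -> object C T with
  | Weak | Strong => fun (G : hypergraph T) W => hrestrict r G W
  | WeakOrd | StrongOrd => fun (G : ohypergraph T) W => ohrestrict r G W
  end.

(** The threshold at which [embedding] describes the subobjects of the class. *)
Definition level (r t : nat) (C : steiner_class) := if is_weak C then r else t.

Definition order_embedding (C : steiner_class) (T U : finType) (F : object C T)
    (H : object C U) (f : vertex (underlying F) -> U) : Prop :=
  is_ordered C ->
  forall x y, ((val x, val y) \in ordr F) = ((f x, f y) \in ordr H).

Lemma hcopyP r s (T U : finType) (F : hypergraph T) (H X : hypergraph U) :
  Defs.rgraph r H -> s <= r ->
  (strongly_induced r s X H /\ exists f : vertex X -> vertex F, is_iso f) <->
  exists f : vertex F -> U, [/\ forall v, f v \in vset H,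
    embedding s (edges_on F) (eset H) f & X = hrestrict r H (f @: setT)].
Proof.
move=> rH sr; split=> [[sXH [phi iso]]|[f [fV fe ->]]].
  have [f [_ imf EX fe]] := embedding_of_copy sXH iso.
  exists f; split=> // [v|]; last by rewrite imf.
  by apply: (subsetP sXH.1.1); rewrite -imf imset_f.
have [si [phi [iso _]]] := copy_of_embedding rH sr fV fe.
by split=> //; exists phi.
Qed.

Lemma ohcopyP r s (T U : finType) (F : ohypergraph T) (H X : ohypergraph U) :
  Defs.rgraph r H -> s <= r ->
  ((strongly_induced r s X H /\ inherits_order X H) /\
    exists f : vertex X -> vertex F, is_iso f /\ preserves_order f) <->
  exists f : vertex F -> U, [/\ forall v, f v \in vset H,
    embedding s (edges_on F) (eset H) f,
    forall x y, ((val x, val y) \in vord F) = ((f x, f y) \in vord H)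
    & X = ohrestrict r H (f @: setT)].
Proof.
move=> rH sr; split=> [[[sXH ord] [phi [iso pres]]]|[f [fV fe fo ->]]].
  have [f [valf imf EX fe]] := embedding_of_copy sXH iso.
  have fVX v : f v \in vset X by rewrite -imf imset_f.
  exists f; split=> //.
  - by move=> v; apply: (subsetP sXH.1.1).
  - move=> v w; have [psi _ psiK] := iso.1.
    rewrite -(psiK v) -(psiK w) -pres !valf ord inE in_setX /=.
    by rewrite !fVX !andbT.
  - rewrite imf; case: X EX ord {sXH phi iso pres f valf imf fe fVX} => X R /= EX ord.
    by rewrite /ohrestrict -EX; congr OHypergraph.
have [si [phi [iso valf]]] := copy_of_embedding rH sr fV fe.
split=> //; exists phi; split=> // x y.
by rewrite fo -!valf inE in_setX (valP x) (valP y) !andbT.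
Qed.

Lemma in_class_steiner C r t T (G : object C T) :
  in_class r t G -> steiner r t (underlying G).
Proof. by case: C G => G //= []. Qed.

(** Reduces all four classes to injective maps. A subobject is determined by its vertex set, so a
    copy is the restriction to the image of a map. *)
Lemma copyP C r t (T U : finType) (F : object C T) (H X : object C U) :
  steiner r t (underlying H) -> t <= r ->
  copy r t H F X <->
  exists f : vertex (underlying F) -> U, [/\ forall v, f v \in vset (underlying H),
    embedding (level r t C) (edges_on (underlying F)) (eset (underlying H)) f,
    order_embedding H f & X = restrict r H (f @: setT)].
Proof.
case: C F H X => F H X [rH sH] tr /=.
- have [H1 H2] := hcopyP F X rH (leqnn r).
  split=> [[ind iso]|[f [fV fe _ E]]].
    have [|f [fV fe E]] := H1; last by exists f.
    by split=> //; apply: induced_strongly.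
  have [|[ind _] iso] := H2; first by exists f.
  by split.
- have [H1 H2] := ohcopyP F X rH (leqnn r).
  split=> [[[ind ord] iso]|[f [fV fe fo E]]].
    have [|f [fV fe fo E]] := H1; last by exists f; split=> // _; apply: fo.
    by do 2!split=> //; apply: induced_strongly.
  have [|[[ind _] ord] iso] := H2; first by exists f; split=> //; apply: fo.
  by split.
- have [H1 H2] := hcopyP F X rH tr.
  split=> [[ind iso]|[f [fV fe _ E]]].
    by have [|f [fV fe E]] := H1; last by exists f.
  by apply: H2; exists f.
- have [H1 H2] := ohcopyP F X rH tr.
  split=> [[[ind ord] iso]|[f [fV fe fo E]]].
    by have [|f [fV fe fo E]] := H1; last by exists f; split=> // _; apply: fo.
  by apply: H2; exists f; split=> //; apply: fo.
Qed.

(** In the unordered classes any key injective on the vertices will do, so every object comes with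
    an order to argue with. *)
Definition represents (C : steiner_class) (T : finType) (G : object C T)
    (k : T -> nat) : Prop :=
  {in vset (underlying G) &, injective k} /\
  (is_ordered C -> {in vset (underlying G) &, forall x y,
     ((x, y) \in ordr G) = (k x <= k y)}).

Lemma linear_order_key (T : finType) (V : {set T}) (R : {set T * T}) :
  linear_order_on V R ->
  exists2 k : T -> nat, {in V &, injective k} &
    {in V &, forall x y, ((x, y) \in R) = (k x <= k y)}.
Proof.
case=> sub refl anti trans total; pose k x := #|[set y | (y, x) \in R]|.
have kE : {in V &, forall x y, ((x, y) \in R) = (k x <= k y)}.
  move=> x y xV yV; apply/idP/idP => [xy|].
    apply: subset_leq_card; apply/subsetP=> z; rewrite !inE => zx.
    exact: trans zx xy.
  apply: contraTT => nxy; rewrite -ltnNge.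
  have yx : (y, x) \in R by have [|//] := total x y xV yV; rewrite (negPf nxy).
  apply: proper_card; apply/properP; split.
    by apply/subsetP=> z; rewrite !inE => zy; apply: trans zy yx.
  by exists x; rewrite !inE ?refl.
exists k => // x y xV yV kxy; apply: anti; by rewrite kE // kxy.
Qed.

Lemma exists_key C r t (T : finType) (G : object C T) :
  in_class r t G -> exists k, represents G k.
Proof.
have unord (V : {set T}) : {in V &, injective (fun x : T => enum_rank x : nat)}.
  by move=> x y _ _ /val_inj /enum_rank_inj.
case: C G => G; rewrite /represents /=.
- by exists (fun x => enum_rank x : nat); split.
- by case=> _ /linear_order_key[k ki kE]; exists k.
- by exists (fun x => enum_rank x : nat); split.
- by case=> _ /linear_order_key[k ki kE]; exists k.
Qed.

Definition full_object (C : steiner_class) (B : finType) (E : {set {set B}})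
    (k : B -> nat) : object C B :=
  match C return object C B with
  | Weak | Strong => Hypergraph setT E
  | WeakOrd | StrongOrd =>
      OHypergraph (Hypergraph setT E) [set z | k z.1 <= k z.2]
  end.

Section FullObject.
Variables (C : steiner_class) (r t : nat) (B : finType) (E : {set {set B}}).
Variable k : B -> nat.
Hypotheses (ki : injective k) (SE : steiner_edges r t E).

Lemma full_underlying : underlying (full_object C E k) = Hypergraph setT E.
Proof. by case: C. Qed.

Lemma full_in_class : in_class r t (full_object C E k).
Proof.
have lin : linear_order_on setT [set z | k z.1 <= k z.2].
  split=> [|x _|x y|x y z|x y _ _]; rewrite ?inE //=.
  - by apply/subsetP=> -[x y] _; rewrite !inE.
  - by move=> xy yx; apply: ki; apply/eqP; rewrite eqn_leq xy.
  - exact: leq_trans.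
  - exact/orP/leq_total.
by have st := steiner_full SE; case: C => /=; do ?[exact: st | exact: lin | split].
Qed.

Lemma full_represents : represents (full_object C E k) k.
Proof. by case: C; split=> [x y _ _ /ki|] //= _ x y _ _; rewrite inE. Qed.

End FullObject.

Lemma restrict_underlying r C (T : finType) (H : object C T) (W : {set T}) :
  underlying (restrict r H W) = hrestrict r (underlying H) W.
Proof. by case: C H. Qed.

Lemma restrict_restrict r C (T : finType) (H : object C T) (W W' : {set T}) :
  W' \subset W -> restrict r (restrict r H W) W' = restrict r H W'.
Proof.
move=> sW'W; have hE (G : hypergraph T) :
    hrestrict r (hrestrict r G W) W' = hrestrict r G W'.
  congr Hypergraph; apply/setP=> e; rewrite !inE.
  case: (e \in eset G) => //=; case sW': (e \subset W'); rewrite /= ?andbF //.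
  by rewrite (subset_trans sW' sW'W) andbb.
case: C H => H //=; rewrite /ohrestrict /= hE; congr OHypergraph.
- by rewrite -setIA; congr (_ :&: _); apply/setIidPr; apply: setXS.
- by rewrite -setIA; congr (_ :&: _); apply/setIidPr; apply: setXS.
Qed.

Lemma restrict_represents r C (T : finType) (H : object C T) (W : {set T}) k :
  W \subset vset (underlying H) -> represents H k -> represents (restrict r H W) k.
Proof.
move=> /subsetP sW [ki kE]; split.
  rewrite restrict_underlying => x y xW yW; apply: ki; exact: sW.
move=> oC x y; rewrite restrict_underlying /= => xW yW.
rewrite -kE ?sW //; case: C H oC {ki kE sW} => //= H _; by rewrite !inE xW yW !andbT.
Qed.

Lemma restrict_steiner r t C (T : finType) (H : object C T) (W : {set T}) :
  W \subset vset (underlying H) -> steiner r t (underlying H) ->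
  steiner r t (underlying (restrict r H W)).
Proof.
move=> sW [rH sH]; rewrite restrict_underlying; split=> [e|S SW cS e e'].
  by rewrite !inE => /andP[_ /andP[-> /eqP->]].
rewrite !inE => /andP[eH _] /andP[e'H _]; apply: (sH S) => //.
exact: subset_trans SW sW.
Qed.

Lemma order_embeddingP C (T U : finType) (F : object C T) (H : object C U) kF kH
    (f : vertex (underlying F) -> U) :
  represents F kF -> represents H kH -> (forall v, f v \in vset (underlying H)) ->
  order_embedding H f <->
  (is_ordered C -> monotone (fun v : vertex (underlying F) => kF (val v)) kH f).
Proof.
move=> [kFi kFE] [kHi kHE] fV; split=> fo oC.
  have {}fo := fo oC; have {}kFE := kFE oC; have {}kHE := kHE oC.
  move=> v w; rewrite !ltnNge; apply: contra.
  by rewrite -kHE // -fo kFE //; apply: valP.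
have ki : injective (fun v : vertex (underlying F) => kF (val v)).
  by move=> v w /kFi E; apply: val_inj; apply: E; apply: valP.
move=> v w; rewrite (kFE oC) ?(valP v) ?(valP w) // (kHE oC) //.
by rewrite leqNgt -(monotone_lt ki (fo oC)) -leqNgt.
Qed.

Lemma embedding_leq s s' (B U : finType) (E : {set {set B}}) (E' : {set {set U}}) f :
  s <= s' -> embedding s E E' f -> embedding s' E E' f.
Proof. by move=> ss' [fi f1 f2]; split=> // e eE /(leq_trans ss')/(f2 e eE). Qed.

(** * The positive half *)

(** An edge with [t] points in the image shares them with the image of an edge of [K], by
    completeness, and therefore equals it. *)
Lemma complete_embedding r t (K B : finType) (EK : {set {set K}})
    (EB : {set {set B}}) (q : K -> B) :
  steiner_edges r t EB -> t <= r ->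
  (t < r -> forall S : {set K}, #|S| = t -> exists2 e, e \in EK & S \subset e) ->
  embedding r EK EB q -> embedding t EK EB q.
Proof.
move=> [_ SB] tr compl [qi q1 q2]; split=> // e eB le.
have [ltr|rt] := ltnP t r; last by apply: q2 => //; apply: leq_trans le.
have [S' S'S cS'] := exists_subset_card le.
have S'q : q @: (q @^-1: S') = S'.
  apply/setP=> b; apply/imsetP/idP => [[i]|bS]; first by rewrite inE => iS ->.
  have := subsetP S'S b bS; rewrite inE => /andP[_ /imsetP[i _ bi]].
  by exists i => //; rewrite inE -bi.
have [|f fK Sf] := compl ltr (q @^-1: S').
  by rewrite -(card_imset _ qi) S'q.
exists f => //; apply: SB => //; first exact: q1.
rewrite -cS'; apply: subset_leq_card; rewrite subsetI.
by rewrite (subset_trans S'S) ?subsetIl //= -S'q imsetS.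
Qed.

Lemma embedding_factor s t (K B P : finType) (EK : {set {set K}})
    (EB : {set {set B}}) (EP : {set {set P}}) (x : B -> P) (q : K -> B) :
  embedding t EB EP x -> {in EP, forall e : {set P}, t <= #|e|} ->
  embedding s EK EP (fun i => x (q i)) -> embedding s EK EB q.
Proof.
move=> [xi x1 x2] szP [fi f1 f2].
have imE (e : {set K}) : (fun i => x (q i)) @: e = x @: (q @: e).
  by rewrite -imset_comp.
split=> [i j E|e eK|e eB le].
- by apply: fi; rewrite /= E.
- have eP := f1 e eK; rewrite imE in eP.
  have [|e0 e0B /(imset_inj xi) -> //] := x2 _ eP.
  by rewrite (setIidPl _) ?szP // imsetS ?subsetT.
have [|e0 e0K] := f2 _ (x1 _ eB); last first.
  by rewrite imE => /(imset_inj xi) ->; exists e0.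
by rewrite imE -imsetI ?card_imset // => ? ? _ _; apply: xi.
Qed.

Lemma embedding_perm s (K B : finType) (EK : {set {set K}}) (EB : {set {set B}})
    (q : K -> B) (sg : {perm K}) :
  (forall e : {set K}, (e \in EK) = (sg @: e \in EK)) ->
  embedding s EK EB q -> embedding s EK EB (fun i => q (sg i)).
Proof.
move=> aut [qi q1 q2].
have imE (e : {set K}) : (fun i => q (sg i)) @: e = q @: (sg @: e).
  by rewrite -imset_comp.
have sT : sg @: setT = setT.
  by apply/setP=> i; rewrite inE -(permKV sg i) imset_f.
split=> [i j /qi /perm_inj //|e|e eB].
  by rewrite imE aut => /q1.
rewrite imE sT => /(q2 _ eB)[e0 e0K ->].
have sgK : sg @: (sg^-1%g @: e0) = e0.
  rewrite -imset_comp -[RHS]imset_id; apply: eq_imset => i /=; by rewrite permKV.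
exists (sg^-1%g @: e0); first by rewrite aut sgK.
by rewrite [RHS]imE sgK.
Qed.

(** Keys order [F] and [G] in every class. What remains is that each copy of [F] in the chosen copy
    of [G] has the image of a monotone strong embedding. *)
Theorem ramsey_positive (r t : nat) (C : steiner_class) (TF : finType)
    (F : object C TF) : 2 <= t -> t <= r -> in_class r t F ->
  (~~ is_ordered C -> homogeneous (underlying F)) ->
  (is_weak C -> t < r -> complete t (underlying F)) ->
  ramsey_property r t F.
Proof.
move=> t2 tr hF homF comF TG G c hG c0.
have t0 : 0 < t by apply: leq_trans t2.
have [kF repF] := exists_key hF; have [kG repG] := exists_key hG.
have keyi T (A : object C T) k : represents A k ->
    injective (fun v : vertex (underlying A) => k (val v)).
  by case=> ki _ v w E; apply: val_inj; apply: ki E; apply: valP.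
have SG := steiner_edges_on (in_class_steiner hG).
have [P [EP [kP [SP kPi Hchi]]]] := ordered_strong_ramsey
  (edges_on (underlying F)) t0 c0 (keyi _ _ _ repG) (keyi _ _ _ repF) SG.
pose H := full_object C EP kP.
have uH : underlying H = Hypergraph setT EP by apply: full_underlying.
have sH : steiner r t (underlying H) by rewrite uH; apply: steiner_full.
have repH : represents H kP by apply: full_represents.
exists P, H; split; first exact: full_in_class.
move=> chi; have [x [xe mx [col Hcol]]] :=
  Hchi (fun w => chi (restrict r H (w @: setT))).
have tlev : t <= level r t C by rewrite /level; case: ifP.
pose G' := restrict r H (x @: setT).
exists G'.
  apply/(copyP _ _ sH tr); exists x; split=> //.
  - by move=> v; rewrite uH inE.
  - by rewrite uH; apply: embedding_leq xe.
  - by apply/(order_embeddingP repG repH) => // v; rewrite uH inE.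
have subV : x @: setT \subset vset (underlying H) by rewrite uH subsetT.
have repG' : represents G' kP by apply: restrict_represents.
have uG' : underlying G' = hrestrict r (underlying H) (x @: setT).
  exact: restrict_underlying.
exists col => X; case/(copyP _ _ (restrict_steiner subV sH) tr).
move=> f [fV fe fo ->]; rewrite uG' /= in fV.
have {}fo : is_ordered C ->
    monotone (fun v : vertex (underlying F) => kF (val v)) kP f.
  by apply/(order_embeddingP repF repG') => //; rewrite uG'.
have fx v : exists b, f v = x b by have /imsetP[b _ ->] := fV v; exists b.
have {fx}[q fq] := fin_all_exists fx.
have imf : f @: setT \subset x @: setT.
  by apply/subsetP=> _ /imsetP[v _ ->].
rewrite restrict_restrict //.
have fe' : embedding (level r t C) (edges_on (underlying F)) EP f.
  have [fi f1 f2] := fe; split=> // [e /f1|e eP le].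
    by rewrite uG' uH inE => /andP[].
  apply: f2 => //; have [_ _ x2] := xe; have [|e0 _ eE] := x2 e eP.
    apply: leq_trans (leq_trans tlev le) _; apply: subset_leq_card.
    exact: setIS.
  by rewrite uG' uH !inE eP (SP.1 e eP) eqxx eE imsetS ?subsetT.
have qe : embedding t (edges_on (underlying F)) (edges_on (underlying G)) q.
  have : embedding (level r t C) (edges_on (underlying F)) (edges_on (underlying G)) q.
    apply: (embedding_factor xe); first by move=> e /SP.1 ->.
    exact: eq_embedding fe'.
  (* In a weak class completeness of [F] lowers the threshold from [r] to [t]. *)
  rewrite /level; case wC: (is_weak C) => //.
  apply: complete_embedding => // ltr S cS.
  have [||e eF Se] := @comF wC ltr (val @: S).
  - by apply/subsetP=> _ /imsetP[v _ ->]; apply: valP.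
  - by rewrite card_imset //; apply: val_inj.
  have [rF _] := in_class_steiner hF.
  exists (val @^-1: e); first by rewrite inE imset_val_preim //; apply: (rF e eF).1.
  apply/subsetP=> v vS; rewrite inE; apply: (subsetP Se).
  exact: imset_f.
have [oC|uC] := boolP (is_ordered C).
  have -> : f @: setT = fcomp x [ffun v => q v] @: setT.
    by apply: eq_imset => v; rewrite !ffunE fq.
  apply: Hcol; first by apply: eq_embedding qe => v; rewrite ffunE.
  move=> v w /(fo oC); rewrite !fq !ffunE (monotone_lt (keyi _ _ _ repG) mx).
  by [].
(* Without an order on [F], [q] is made monotone by a permutation of [F]. This is an automorphism by
   homogeneity, and the image stays the same. *)
have qi : injective (fun v => kG (val (q v))).
  have [qi _ _] := qe; by move=> v w /(keyi _ _ _ repG) /qi.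
have [sg msg] := monotone_reorder (k := fun v => kF (val v))
  (k' := fun v : vertex (underlying G) => kG (val v)) (keyi _ _ _ repF) qi.
have -> : f @: setT = fcomp x [ffun v => q (sg v)] @: setT.
  apply/setP=> z; apply/imsetP/imsetP => -[v _ ->].
    by exists (sg^-1%g v); rewrite ?inE // !ffunE permKV fq.
  by exists (sg v); rewrite ?inE // !ffunE fq.
apply: Hcol; last by move=> v w /msg; rewrite !ffunE.
apply: (@eq_embedding t _ _ _ _ (fun v => q (sg v))).
  by move=> v; rewrite ffunE.
apply: embedding_perm qe => e; rewrite !inE.
by have [_ ->] := homF uC sg.
Qed.

(** * The ordering property *)

Lemma embedding_comp s (A B U : finType) (EA : {set {set A}}) (EB : {set {set B}})
    (EU : {set {set U}}) (f : A -> B) (g : B -> U) :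
  embedding s EA EB f -> embedding s EB EU g -> embedding s EA EU (fun x => g (f x)).
Proof.
move=> [fi f1 f2] [gi g1 g2].
have imE (e : {set A}) : (fun x => g (f x)) @: e = g @: (f @: e).
  by rewrite -imset_comp.
split=> [x y /gi /fi //|e /f1 /g1|e eU]; rewrite imE // => le.
have [|e1 e1B E] := g2 e eU.
  apply: leq_trans le _; apply: subset_leq_card; apply: setIS.
  by apply: imsetS; apply: subsetT.
have [|e0 e0A E0] := f2 e1 e1B; last by exists e0; rewrite // imE -E0.
by move: le; rewrite E -imsetI ?card_imset // => ? ? _ _; apply: gi.
Qed.

Lemma embedding_edge s (B U : finType) (E : {set {set B}}) (E' : {set {set U}}) f
    (e : {set B}) :
  embedding s E E' f -> (forall e, e \in E' -> s <= #|e|) ->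
  (e \in E) = (f @: e \in E').
Proof.
move=> [fi f1 f2] sz; apply/idP/idP => [/f1 //|eE'].
have [|e0 e0E /(imset_inj fi) -> //] := f2 _ eE'.
by rewrite (setIidPl _) ?sz // imsetS ?subsetT.
Qed.

Section LexicographicKey.
Variables (A B : finType) (k1 : A -> nat) (k2 : A -> B -> nat).

Definition lex_key (z : A * B) : nat :=
  k1 z.1 * (\max_(y : A * B) k2 y.1 y.2).+1 + k2 z.1 z.2.

Lemma lex_bound a b : k2 a b < (\max_(y : A * B) k2 y.1 y.2).+1.
Proof. by rewrite ltnS (leq_bigmax (a, b)). Qed.

Lemma lex_key_fst a a' b b' : k1 a < k1 a' -> lex_key (a, b) < lex_key (a', b').
Proof.
move=> lt; rewrite /lex_key /=; set N := (\max_(y : A * B) _).+1.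
apply: leq_trans (leq_addr _ _); apply: (@leq_trans ((k1 a).+1 * N)).
  by rewrite mulSn addnC ltn_add2r lex_bound.
by rewrite leq_mul2r lt orbT.
Qed.

Lemma lex_key_snd a b b' : k2 a b < k2 a b' -> lex_key (a, b) < lex_key (a, b').
Proof. by rewrite /lex_key /= ltn_add2l. Qed.

Lemma lex_key_inj : injective k1 -> (forall a, injective (k2 a)) -> injective lex_key.
Proof.
move=> k1i k2i [a b] [a' b'] E.
case: (ltngtP (k1 a) (k1 a')) => [/lex_key_fst lt|/lex_key_fst lt|/k1i aa'].
- by have := lt b b'; rewrite E ltnn.
- by have := lt b' b; rewrite E ltnn.
move: E; rewrite -aa' /lex_key /= => /addnI /k2i ->. by [].
Qed.

End LexicographicKey.

(** Apply the Ramsey theorem for two-point systems to a system containing every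
    (B, k j) and its reversal. Between any two consecutive vertices we put an
    isolated one, so that the order of the two can be read off from pairs in no
    common edge, which are strong subsystems even for t = 2. *)
Theorem ordering_property (r t : nat) (B J : finType) (E : {set {set B}})
    (k : J -> B -> nat) :
  2 <= t -> steiner_edges r t E -> (forall j, injective (k j)) ->
  exists (U : finType) (EU : {set {set U}}), steiner_edges r t EU /\
  forall (kU : U -> nat) j, injective kU ->
  exists2 f : B -> U, embedding t E EU f & monotone (k j) kU f.
Proof.
move=> t2 SE ki.
pose M := \max_(y : J * B) k y.1 y.2.
have kM j b : k j b <= M by apply: (leq_bigmax (j, b)).
(* The flag [true] reverses the order; as [M] bounds all keys, the truncated subtraction stays
   injective. *)
pose k0 (jd : J * bool) b := if jd.2 then M - k jd.1 b else k jd.1 b.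
have k0i jd : injective (k0 jd).
  case: jd => j [] b b'; rewrite /k0 /=; last exact: ki.
  by move=> eqM; apply: (ki j); have := kM j b; have := kM j b'; lia.
(* Within a block each vertex [(b, false)] is directly followed by its isolated companion
   [(b, true)]. *)
pose key := lex_key (fun jd : J * bool => enum_rank jd : nat)
  (fun jd => lex_key (k0 jd) (fun (_ : B) (i : bool) => i : nat)).
have keyi : injective key.
  apply: lex_key_inj => [? ? /val_inj/enum_rank_inj //|jd].
  by apply: lex_key_inj => // b [] [].
pose put (jd : J * bool) (b : B) := (jd, (b, false)).
have puti jd : injective (put jd) by move=> b b' [].
pose E2 := [set put jd @: e | jd : J * bool in setT, e : {set B} in E].
have meet jd jd' (e e' : {set B}) : 0 < #|put jd @: e :&: put jd' @: e'| -> jd = jd'.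
  by case/card_gt0P=> z /setIP[/imsetP[b _ ->] /imsetP[b' _ []]].
have t0 : 0 < t by apply: leq_trans t2.
have SE2 : steiner_edges r t E2.
  split=> [_ /imset2P[jd e _ eE ->]|]; first by rewrite card_imset ?SE.1.
  move=> _ _ /imset2P[jd e _ eE ->] /imset2P[jd' e' _ e'E ->] le.
  have jj := meet _ _ _ _ (leq_trans t0 le); rewrite -{}jj in le *.
  suff -> : e = e' by [].
  apply: SE.2 => //; move: le.
  by rewrite -imsetI ?card_imset // => ? ? _ _; apply: puti.
have put_emb jd : embedding t E E2 (put jd).
  split=> // [e eE|_ /imset2P[jd' e' _ e'E ->] le].
    by apply/imset2P; exists jd e.
  have jj := meet _ _ _ _ (leq_trans t0 le); rewrite -{}jj.
  by exists e'.
have ki2 : injective nat_of_bool by case=> [] [].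
have [P [EP [kP [SP kPi Hchi]]]] := @ordered_strong_ramsey
  r t 2 _ _ E2 (set0 : {set {set bool}}) key nat_of_bool t0 isT keyi ki2 SE2.
exists P, EP; split=> // kU j kUi.
have [x [xe mx [col Hcol]]] := Hchi (fun w =>
  if kU (w false) < kU (w true) then ord_max else ord0).
(* A pair with an isolated vertex has at most one point in any edge, fewer than [t], so it is a
   strong copy of the edgeless system on [bool]. *)
have pairs z z' : key z < key z' -> z.2.2 || z'.2.2 ->
    (kU (x z) < kU (x z')) = (col == ord_max).
  move=> lt iso; pose q : {ffun bool -> (J * bool) * (B * bool)} :=
    [ffun i => if i then z' else z].
  rewrite -(Hcol q); first by rewrite !ffunE; case: ifP.
    have nzz' : z != z' by apply: contraTneq lt => ->; rewrite ltnn.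
    split=> [i i'|e|_ /imset2P[jd e _ eE ->] le]; rewrite ?inE //.
      rewrite !ffunE; case: i; case: i' => // E'; by rewrite E' eqxx in nzz'.
    have : #|put jd @: e :&: q @: setT| <= 1.
      have sub : put jd @: e :&: q @: setT \subset [set if z.2.2 then z' else z].
        apply/subsetP=> y /setIP[/imsetP[b _ ->] /imsetP[i _]].
        rewrite inE ffunE => yE; apply/eqP; case: i yE => yE; last by rewrite -yE.
        by move: iso; rewrite -yE /= orbF => ->.
      by rewrite -(cards1 (if z.2.2 then z' else z)) subset_leq_card.
    by move/(leq_trans le); rewrite leqNgt t2.
  by case=> [] [] //; rewrite !ffunE.
have step jd b b' : k0 jd b < k0 jd b' ->
    key (put jd b) < key (jd, (b, true)) < key (put jd b').
  by move=> lt; apply/andP; split; apply: lex_key_snd; [apply: lex_key_snd|apply: lex_key_fst].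
have [xi _ _] := xe.
(* If [kU] preserves these pairs, the block of [k j] is used; if it reverses them, the reversed
   block. *)
have [c1|c1] := boolP (col == ord_max).
  exists (fun b => x (put (j, false) b)); first exact: embedding_comp xe.
  move=> b b' lt; have /andP[l1 l2] := step (j, false) _ _ lt.
  apply: (@ltn_trans (kU (x ((j, false), (b, true))))).
    by rewrite pairs.
  by rewrite pairs.
exists (fun b => x (put (j, true) b)); first exact: embedding_comp xe.
move=> b b' lt; have /step/andP[l1 l2] : k0 (j, true) b' < k0 (j, true) b.
  by rewrite /k0 /=; have := kM j b'; lia.
rewrite ltn_neqAle; apply/andP; split.
  by apply: contraTneq lt => /kUi /xi /puti ->; rewrite ltnn.
apply: (@leq_trans (kU (x ((j, true), (b', true))))).
  by rewrite leqNgt pairs.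
by rewrite leqNgt pairs.
Qed.

(** * The negative half *)

Lemma full_vertex_embedding s (U : finType) (G : hypergraph U) (inG : forall u, u \in vset G) :
  embedding s (eset G) (edges_on G) (fun u => Sub u (inG u) : vertex G).
Proof.
have imE (e : {set U}) : val @: ((fun u => Sub u (inG u) : vertex G) @: e) = e.
  by rewrite -imset_comp -[RHS]imset_id; apply: eq_imset.
split=> [u v /(congr1 val)|e eG|e]; rewrite ?SubK //; first by rewrite inE imE.
rewrite inE => eG _; exists (val @: e) => //.
by apply: (imset_inj val_inj); rewrite imE.
Qed.

(** The ordering property is applied to the order that H induces on a copy of U, so
    that also in the unordered classes such a copy contains (B, E) in both orders k1
    and k2. *)
Theorem ramsey_negative (r t : nat) (C : steiner_class) (TF : finType)
    (F : object C TF) (kF : TF -> nat) (B : finType) (E : {set {set B}})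
    (k1 k2 : B -> nat) (i : vertex (underlying F) -> B) :
  2 <= t -> t <= r -> represents F kF -> steiner_edges r t E ->
  injective k1 -> injective k2 ->
  embedding (level r t C) (edges_on (underlying F)) E i ->
  (is_ordered C ->
     monotone (fun v : vertex (underlying F) => kF (val v)) (fun v => k1 (i v)) id /\
     monotone (fun v : vertex (underlying F) => kF (val v)) (fun v => k2 (i v)) id) ->
  (forall (TH : finType) (H : hypergraph TH) (kH : TH -> nat), steiner r t H ->
     exists chi : {set TH} -> bool, forall f1 f2 : B -> TH,
     embedding (level r t C) E (eset H) f1 -> monotone k1 kH f1 ->
     embedding (level r t C) E (eset H) f2 -> monotone k2 kH f2 ->
     chi ((fun v => f1 (i v)) @: setT) != chi ((fun v => f2 (i v)) @: setT)) ->
  ~ ramsey_property r t F.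
Proof.
move=> t2 tr repF SE k1i k2i ie iord Hcol ram.
have [|U [EU [SU HU]]] := @ordering_property r t B bool E
    (fun j => if j then k1 else k2) t2 SE; first by case.
pose kU (u : U) : nat := enum_rank u.
have kUi : injective kU by move=> u v /val_inj/enum_rank_inj.
pose G := full_object C EU kU.
have [TH [H [hH arr]]] := ram U G 2 (full_in_class C kUi SU) isT.
have sH := in_class_steiner hH; have [rH _] := sH.
have [kH repH] := exists_key hH.
have [chi Hchi] := Hcol TH (underlying H) kH sH.
have [G' copyG' [col HG']] :=
  arr (fun X => if chi (vset (underlying X)) then ord_max else ord0).
have [g [gV ge go EG']] := (copyP G G' sH tr).1 copyG'.
have uG : underlying G = Hypergraph setT EU by apply: full_underlying.
have inG u : u \in vset (underlying G) by rewrite uG inE.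
pose g' u := g (Sub u (inG u)).
have g'e : embedding (level r t C) EU (eset (underlying H)) g'.
  have := embedding_comp (full_vertex_embedding (level r t C) inG) ge.
  by rewrite {1}uG.
have [g'i _ _] := g'e.
have kHi : injective (fun u => kH (g' u)).
  by move=> u v /(repH.1) E'; apply: g'i; apply: E'; apply: gV.
have subV : g @: setT \subset vset (underlying H).
  by apply/subsetP=> _ /imsetP[v _ ->].
have uG' : underlying G' = hrestrict r (underlying H) (g @: setT).
  by rewrite EG' restrict_underlying.
(* The copy of [B] in either order lies in [G'], and so does the copy of [F] in it; hence both
   copies of [F] have the colour [col]. *)
have copies j : exists f : B -> TH,
    [/\ embedding (level r t C) E (eset (underlying H)) f,
        monotone (if j then k1 else k2) kH f &
        (if chi ((fun v => f (i v)) @: setT) then ord_max else ord0) = col].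
  have [f fe mf] := HU _ j kHi.
  have tlev : t <= level r t C by rewrite /level; case: ifP.
  have g'fe : embedding (level r t C) E (eset (underlying H)) (fun b => g' (f b)).
    by apply: embedding_comp g'e; apply: embedding_leq fe.
  exists (fun b => g' (f b)); split=> //.
  pose h (v : vertex (underlying F)) := g' (f (i v)).
  have [hi h1 h2] : embedding (level r t C) (edges_on (underlying F))
      (eset (underlying H)) h by exact: embedding_comp g'fe.
  have subh : h @: setT \subset g @: setT.
    by apply/subsetP=> _ /imsetP[v _ ->]; apply: imset_f.
  have hV v : h v \in vset (underlying G').
    by rewrite uG' /= (subsetP subh) // imset_f.
  have <- := HG' (restrict r G' (h @: setT)).
    by rewrite restrict_underlying.
  have sG' : steiner r t (underlying G') by rewrite EG'; apply: restrict_steiner.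
  apply/(copyP _ _ sG' tr); exists h; split=> //.
    split=> // [e eF|e]; rewrite uG' !inE.
      have eH := h1 e eF; rewrite eH (rH _ eH).2 eqxx andbT.
      by apply: subset_trans subh; apply: imsetS; apply: subsetT.
    by case/andP=> eH _; apply: h2.
  apply/(order_embeddingP repF (kH := kH)) => //.
    by rewrite EG'; apply: restrict_represents.
  move=> oC v w lt; have [m1 m2] := iord oC; apply: mf.
  by case: (j); [apply: m1|apply: m2].
have [f1 [f1e m1 E1]] := copies true; have [f2 [f2e m2 E2]] := copies false.
have := Hchi f1 f2 f1e m1 f2e m2; move: E1; rewrite -E2.
by case: (chi _); case: (chi _).
Qed.

(** Take [B] to be [F] itself, and [k2] to be [k] twisted by a permutation [sg] that is not an
    automorphism. A set is coloured by whether it is the image of an embedding monotone for [k]. *)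
Theorem not_homogeneous_not_ramsey (r t : nat) (C : steiner_class) (TF : finType)
    (F : object C TF) : 2 <= t -> t <= r -> in_class r t F ->
  ~~ is_ordered C -> ~ homogeneous (underlying F) -> ~ ramsey_property r t F.
Proof.
move=> t2 tr hF uC nhom; have [kF repF] := exists_key hF.
pose K := vertex (underlying F); pose EF := edges_on (underlying F).
pose k (v : K) := kF (val v).
have ki : injective k.
  by case: repF => kFi _ v w E; apply: val_inj; apply: kFi E; apply: valP.
have SF : steiner_edges r t EF := steiner_edges_on (in_class_steiner hF).
have [/forallP aut|/forallPn[sg nsg]] :=
    boolP [forall sg : {perm K}, [forall e : {set K}, (e \in EF) == (sg @: e \in EF)]].
  case: nhom => sg; split; first by exists (sg^-1%g); [apply: permK|apply: permKV].
  by move=> e; have /forallP/(_ e)/eqP := aut sg; rewrite !inE.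
pose k2 v := k (sg v).
apply: (@ramsey_negative r t C TF F kF K EF k k2 id) => //.
- by move=> v w /ki /perm_inj.
- by split=> // [e eF|e eF _]; [rewrite imset_id|exists e; rewrite ?imset_id].
- by move=> oC; rewrite oC in uC.
move=> TH H kH sH; pose s := level r t C.
have sz e : e \in eset H -> s <= #|e|.
  by case: sH => rH _ /rH[_ ->]; rewrite /s /level; case: ifP.
exists (fun W => [exists h : {ffun K -> TH},
  [&& embeddingb s EF (eset H) h, monotoneb k kH h & h @: setT == W]]).
move=> f1 f2 f1e m1 f2e m2; have -> : [exists h : {ffun K -> TH},
    [&& embeddingb s EF (eset H) h, monotoneb k kH h
      & h @: setT == (fun v => f1 v) @: setT]].
  apply/existsP; exists [ffun v => f1 v]; apply/and3P; split.
  - by apply/embeddingP; apply: eq_embedding f1e => v; rewrite ffunE.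
  - by apply/monotoneP=> v w /m1; rewrite !ffunE.
  - by apply/eqP; apply: eq_imset => v; rewrite ffunE.
apply/negP=> /eqP/esym/existsP[h /and3P[/embeddingP he /monotoneP mh /eqP imh]].
(* Both maps are monotone for [k2] and have the same image. Their equality would make [sg] an
   automorphism. *)
case/negP: nsg; have hE : (fun v => h (sg v)) =1 f2.
  have k2i : injective k2 by move=> v w /ki /perm_inj.
  apply: (@monotone_imset_inj _ _ k2i _ kH) => //.
  - by move=> v w; apply: mh.
  rewrite -imh; apply/setP=> z; apply/imsetP/imsetP => -[v _ ->].
    by exists (sg v).
  by exists (sg^-1%g v); rewrite ?inE ?permKV.
apply/forallP=> e; apply/eqP.
rewrite (embedding_edge (sg @: e) he sz) (embedding_edge e f2e sz) -imset_comp.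
suff -> : f2 @: e = [set (h \o sg) v | v in e] by [].
by apply: eq_imset => v; rewrite -hE.
Qed.

(** [B] adds to [F] one edge [e0] through [S] with [r - t] new vertices, which [k1] puts above [F]
    and [k2] below. As [S] lies in no edge, [B] is again a Steiner system. *)
Theorem not_complete_not_ramsey (r t : nat) (C : steiner_class) (TF : finType)
    (F : object C TF) : 2 <= t -> t < r -> in_class r t F ->
  is_weak C -> ~ complete t (underlying F) -> ~ ramsey_property r t F.
Proof.
move=> t2 ltr hF wC ncom; have [kF repF] := exists_key hF.
pose K := vertex (underlying F); pose EF := edges_on (underlying F).
pose k (v : K) := kF (val v).
have ki : injective k.
  by case: repF => kFi _ v w E; apply: val_inj; apply: kFi E; apply: valP.
have sF := in_class_steiner hF; have [rF _] := sF.
have SF : steiner_edges r t EF := steiner_edges_on sF.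
have [S cS nS] : exists2 S : {set K}, #|S| = t &
    forall e, e \in EF -> ~~ (S \subset e).
  have [/forallP com|/forallPn[S]] := boolP [forall S : {set K}, (#|S| == t) ==>
      [exists e in EF, S \subset e]].
    case: ncom => S SF' cS.
    have [|e eF Se] := exists_inP (implyP (com (val @^-1: S)) _).
      by rewrite -(card_imset _ val_inj) imset_val_preim // cS.
    exists (val @: e); first by move: eF; rewrite inE.
    by rewrite -(imset_val_preim SF') imsetS.
  rewrite negb_imply => /andP[/eqP cS /exists_inPn nS].
  by exists S.
pose B := (K + 'I_(r - t))%type.
pose e0 : {set B} := inl @: S :|: inr @: setT.
pose E : {set {set B}} := e0 |: [set inl @: e | e : {set K} in EF].
have inli : injective (inl : K -> B) by move=> v w [].
have inri : injective (inr : 'I_(r - t) -> B) by move=> v w [].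
have e0inl (e : {set K}) : e0 :&: inl @: e = inl @: (S :&: e).
  apply/setP=> -[v|x]; rewrite !inE.
    rewrite !mem_imset // inE; congr (_ && _).
    by rewrite orb_idr // => /imsetP[].
  by apply/andP/imsetP => [[_ /imsetP[]]|[]].
have ce0 : #|e0| = r.
  rewrite cardsU (_ : _ :&: _ = set0) ?cards0 ?subn0.
    by rewrite !card_imset // cS cardsT card_ord subnKC // ltnW.
  by apply/setP=> -[v|x]; rewrite !inE; apply/negP=> /andP[/imsetP[? _ ?] /imsetP[]].
have meet e : e \in EF -> #|e0 :&: inl @: e| < t.
  move=> eF; rewrite e0inl card_imset // ltnNge -cS; apply: contra (nS e eF) => le.
  have /eqP <- : S :&: e == S by rewrite eqEcard subsetIl.
  exact: subsetIr.
have SE : steiner_edges r t E.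
  split=> [e|e e'].
    by rewrite !inE => /orP[/eqP->//|/imsetP[e1 e1F ->]]; rewrite card_imset // SF.1.
  rewrite !inE => /orP[/eqP->|/imsetP[e1 e1F ->]] /orP[/eqP->|/imsetP[e2 e2F ->]] //.
  - by rewrite leqNgt meet.
  - by rewrite setIC leqNgt meet.
  rewrite -imsetI ?card_imset // => [le|? ? _ _]; last exact: inli.
  by rewrite (SF.2 e1 e2).
pose M := \max_(v : K) k v.
have kM v : k v <= M by apply: leq_bigmax.
pose k1 (b : B) := match b with inl v => k v | inr x => M.+1 + x end.
pose k2 (b : B) := match b with inl v => r + k v | inr x => x : nat end.
have ltx (x : 'I_(r - t)) : x < r by have := ltn_ord x; lia.
(* Weakness enters here: [e0] meets [F] in [t] points, which is below the threshold [r]. *)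
have inlE : embedding r EF E inl.
  split=> // [e eF|e].
    by rewrite !inE; apply/orP; right; apply: imset_f.
  rewrite !inE => /orP[/eqP->|/imsetP[e1 e1F ->] _]; last by exists e1.
  by rewrite e0inl setIT card_imset // cS leqNgt ltr.
apply: (@ramsey_negative r t C TF F kF B E k1 k2 inl) => //; first exact: ltnW.
- move=> [v|x] [w|y] /=.
  + by move/ki->.
  + by have := kM v; lia.
  + by have := kM w; lia.
  + by move/addnI/val_inj->.
- move=> [v|x] [w|y] /=.
  + by move/addnI/ki->.
  + by have := ltx y; lia.
  + by have := ltx x; lia.
  + by move/val_inj->.
- by rewrite /level wC.
- by move=> oC; split=> v w /= lt; rewrite ?ltn_add2l.
rewrite /level wC => TH H kH sH; have [rH _] := sH; have SH := steiner_eset sH.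
exists (fun W => [exists h : {ffun K -> TH}, [exists e in eset H,
  [&& embeddingb r EF (eset H) h, monotoneb k kH h, h @: setT == W, h @: S \subset e &
      [exists y in e, (y \notin W) && [forall z in W, kH z < kH y]]]]]).
move=> f1 f2 f1e m1 f2e m2.
set W1 := _ @: _; set W2 := _ @: _.
have -> : [exists h : {ffun K -> TH}, [exists e in eset H,
  [&& embeddingb r EF (eset H) h, monotoneb k kH h, h @: setT == W1, h @: S \subset e &
      [exists y in e, (y \notin W1) && [forall z in W1, kH z < kH y]]]]].
  have [f1i f11 _] := f1e.
  apply/existsP; exists [ffun v => f1 (inl v)]; apply/exists_inP; exists (f1 @: e0).
    by apply: f11; rewrite !inE eqxx.
  apply/and5P; split.
  - apply/embeddingP; apply: (eq_embedding (f := fun v => f1 (inl v))).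
      by move=> v; rewrite ffunE.
    exact: embedding_comp f1e.
  - by apply/monotoneP=> v w lt; rewrite !ffunE; apply: m1.
  - by apply/eqP; apply: eq_imset => v; rewrite ffunE.
  - apply/subsetP=> _ /imsetP[v vS ->]; rewrite ffunE; apply: imset_f.
    by rewrite !inE imset_f.
  have x0 : 'I_(r - t) by exists 0; rewrite subn_gt0.
  apply/exists_inP; exists (f1 (inr x0)).
    by apply: imset_f; apply/setUP; right; apply: imset_f; rewrite inE.
  apply/andP; split; first by apply/imsetP=> -[v _ /f1i].
  apply/forall_inP=> _ /imsetP[v _ ->]; apply: m1 => /=.
  by rewrite ltnS; apply: leq_trans (kM v) (leq_addr _ _).
apply/negP=> /eqP/esym/existsP[h /exists_inP[e eH /and5P[/embeddingP he]]].
move=> /monotoneP mh /eqP imh Se /exists_inP[y ye /andP[yW /forall_inP Hy]].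
have hE : h =1 (fun v => f2 (inl v)).
  apply: (@monotone_imset_inj _ _ ki _ kH) => //.
  by move=> v w lt; apply: m2; rewrite /= ltn_add2l.
have [f2i f21 _] := f2e.
(* Both edges contain the copy of [S]. The vertex [y] above the copy of [F] would then be a new
   vertex, but [k2] puts these below. *)
have eE : e = f2 @: e0.
  apply: SH.2 => //; first by apply: f21; rewrite !inE eqxx.
  have [hi _ _] := he; apply: (@leq_trans #|h @: S|).
    by rewrite card_imset ?cS.
  apply: subset_leq_card.
  rewrite subsetI Se; apply/subsetP=> _ /imsetP[v vS ->]; rewrite hE; apply: imset_f.
  by rewrite !inE imset_f.
move: ye yW Hy; rewrite eE => /imsetP[[v|x] _ ->]; first by rewrite imset_f.
have /card_gt0P[v vS] : 0 < #|S| by rewrite cS; apply: leq_trans t2.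
move=> _ /(_ (f2 (inl v))); rewrite imset_f // => /(_ isT).
rewrite ltnNge => /negP[]; apply: ltnW; apply: m2 => /=.
exact: leq_trans (ltx x) (leq_addr _ _).
Qed.

Theorem theorem1p11 (r t : nat) (C : steiner_class) (TF : finType)
    (F : object C TF) (ht : 2 <= t) (htr : t <= r) (hF : in_class r t F) :
  let cond_i := ~~ is_ordered C -> homogeneous (underlying F) in
  let cond_ii := is_weak C -> t < r -> complete t (underlying F) in
  (cond_i /\ cond_ii -> ramsey_property r t F) /\
  (~ cond_i \/ ~ cond_ii -> ~ ramsey_property r t F).
Proof.
move=> cond_i cond_ii; split; first by case; apply: ramsey_positive.
case=> ncond.
  have [oC|uC] := boolP (is_ordered C); first by case: ncond; rewrite /cond_i oC.
  by apply: not_homogeneous_not_ramsey => // hom; apply: ncond.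
case: (boolP (is_weak C)) => [wC|sC]; last by case: ncond => wC; rewrite wC in sC.
have [tr|rt] := ltnP t r; last by case: ncond => _ tr; rewrite ltnNge rt in tr.
by apply: not_complete_not_ramsey => // com; apply: ncond.
Qed.
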